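(* Let all batches have the same fixed size $n_k=m>0$, let $P\in\mathcal P(\Theta)$ be a data-independent prior with $\pi_P=\pi_0$, let $\mathcal C(\Theta)\subset\mathcal P(\Theta)$, and let $\lambda>0$, $\delta\in(0,1]$. Let $(\pi_k)_{k\ge0}$ be the policies produced by the sequential logarithmic smoothing algorithm: for each $k\ge 0$, $\pi_k$ collects $S_k$, and $\pi_{k+1}=\pi_{\hat Q_{k+1}}$ with $$\hat Q_{k+1}\in\operatorname*{arg\,min}_{Q\in\mathcal C(\Theta)}\Big\{\hat R^{\lambda\text{-}\mathrm{LS}}_{0:k}(\pi_Q)+\frac{\operatorname{KL}(Q,P)}{\lambda(k+1)m}\Big\}.$$ Let $Q_\star\in\operatorname*{arg\,min}_{Q\in\mathcal C(\Theta)}R(\pi_Q)$ and $\pi_\star=\pi_{Q_\star}$. Then, with probability at least $1-\delta$ over $S$, for all $k\ge0$, $$R(\pi_{k+1})-R(\pi_\star)\le\frac{\lambda}{k+1}\sum_{j=0}^k\mathcal S_j(\pi_\star)+2\,\frac{\operatorname{KL}(Q_\star,P)+\log\frac2\delta}{\lambda(k+1)m},$$ where $\mathcal S_j(\pi):=\mathbb E_{(x,a,c)\sim P(\pi_j)}\Big[\frac{\pi(a\mid x)c^2}{\pi_j^2(a\mid x)}\Big]$.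
   Context: Contextual bandit: $\mathcal X\subset\mathbb R^d$ is a compact context space, $\mathcal A=\{1,\dots,K\}$ a finite action set, a policy $\pi$ maps each $x\in\mathcal X$ to a probability distribution $\pi(\cdot\mid x)$ on $\mathcal A$. Contexts are drawn i.i.d. from an unknown law $\nu$ on $\mathcal X$; given context $x$ and action $a$, the cost $c\in[-1,0]$ is drawn from an unknown law $p(\cdot\mid x,a)$. $P(\pi)=\nu\times\pi\times p$ denotes the law of $(x,a,c)$ when $x\sim\nu$, $a\sim\pi(\cdot\mid x)$, $c\sim p(\cdot\mid x,a)$ (not to be confused with the prior $P$). The risk of $\pi$ is $R(\pi)=\mathbb E_{(x,a,c)\sim P(\pi)}[c]$. Sequential data: $\pi_0$ is a fixed initial policy. At time $k\ge 0$ the current policy $\pi_k$ collects a batch $S_k=\{(x_i,a_i,c_i): i\in I_k\}$, $|I_k|=n_k$, with the index sets $I_k$ disjoint; $\mathcal F_k$ is the $\sigma$-algebra generated by $S_0,\dots,S_k$ ($\mathcal F_{-1}$ trivial), and $S=\bigcup_k S_k$. Conditionally on $\mathcal F_{k-1}$, the triples in $S_k$ are mutually independent with law $P(\pi_k)$. The policy $\pi_{k+1}$ is $\mathcal F_k$-measurable. In $\mathcal S_j(\pi)$ the expectation is over a fresh triple, with $\pi_j$ held fixed. Policy parametrization: $\Theta$ is a parameter space, $f_\theta:\mathcal X\to\mathcal A$ for $\theta\in\Theta$ are predictors, $\mathcal P(\Theta)$ is the set of probability distributions on $\Theta$; for $Q\in\mathcal P(\Theta)$, $\pi_Q(a\mid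 x)=\mathbb E_{\theta\sim Q}[\mathbf 1\{f_\theta(x)=a\}]$. $\operatorname{KL}(Q,P)=\mathbb E_Q[\log(dQ/dP)]$ is the Kullback–Leibler divergence. Logarithmic smoothing estimator (here with all $n_j=m$): $$\hat R^{\lambda\text{-}\mathrm{LS}}_{0:k}(\pi)=-\frac{1}{(k+1)m}\sum_{j=0}^k\sum_{i\in I_j}\frac{\pi(a_i\mid x_i)}{\lambda}\log\Big(1-\frac{\lambda c_i}{\pi_j(a_i\mid x_i)}\Big).$$
   Formalization: The bound at step k is claimed only on outcomes where each of π_0,…,π_k covers π_⋆ (for ν-a.e. x, π_j(a|x)=0 implies π_⋆(a|x)=0); without coverage the literal claim fails, e.g. two constant predictors, C={δ_1,δ_2}, uniform prior, costs −0.1 and −1. *)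

(* Defs.v *)
From HB Require Import structures.
From mathcomp Require Import all_boot all_order all_algebra.
From mathcomp Require Import all_classical all_reals all_analysis.

Set Implicit Arguments.
Unset Strict Implicit.
Unset Printing Implicit Defensive.

Import Order.TTheory GRing.Theory Num.Theory.
Import numFieldNormedType.Exports.

Local Open Scope classical_set_scope.
Local Open Scope ring_scope.
Local Open Scope ereal_scope.

Definition ctx (R : realType) (d : nat) :=
  g_sigma_algebraType (@open 'rV[R]_d).

(* The action set is 'I_K.+1: the parameter K is the number of actions minus
   one, since measurable types are nonempty. *)
HB.instance Definition _ (K : nat) := isPointed.Build 'I_K.+1 ord0.
HB.instance Definition _ (K : nat) :=
  @isMeasurable.Build default_measure_display 'I_K.+1
    (@discrete_measurable 'I_K.+1) (@discrete_measurable0 'I_K.+1)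
    (@discrete_measurableC 'I_K.+1) (@discrete_measurableU 'I_K.+1).

Section bandit.
Context {R : realType} {d K : nat}.

Definition triple := (ctx R d * 'I_K.+1 * R)%type.

(* Policies are total functions, but only their values on the context space X
   are ever used. *)
Definition policy := ctx R d -> 'I_K.+1 -> R.

Section model.
Variables (X : set (ctx R d)) (nu : probability (ctx R d) R).
Variable p : R.-pker (ctx R d * 'I_K.+1)%type ~> R.

(* The measure nu x pi x p on triples (x, a, c), given through its iterated
   integral. *)
Definition expectation_policy (pi : policy) (g : triple -> \bar R) : \bar R :=
  \int[nu]_(x in X) \sum_(a < K.+1)
    ((pi x a)%:E * \int[p (x, a)]_c g (x, a, c)).

Definition law_policy (pi : policy) (B : set triple) : \bar R :=
  expectation_policy pi (fun z => (\1_B z)%:E).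

Definition risk (pi : policy) : \bar R :=
  expectation_policy pi (fun z => (z.2)%:E).

Definition second_moment (pij pi : policy) : \bar R :=
  expectation_policy pij
    (fun z => (pi z.1.1 z.1.2 * z.2 ^+ 2 / (pij z.1.1 z.1.2) ^+ 2)%:E).

(* The importance weights pi(a|x) / pij(a|x) are well defined nu-a.e.; without
   this, second_moment ignores the actions that pij never plays, as the ratio
   is then integrated over a null event. *)
Definition covers (pij pi : policy) : Prop :=
  {ae nu, forall x, X x -> forall a, pij x a = 0%R -> pi x a = 0%R}.

End model.

Section parametrization.
Context {dT : measure_display} {Theta : measurableType dT}.

Definition mix_policy (f : Theta -> ctx R d -> 'I_K.+1)
    (Q : probability Theta R) : policy :=
  fun x a => (\int[Q]_t ((f t x == a)%:R : R))%R.

Definition KL (Q P : probability Theta R) : \bar R :=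
  if `[< Q `<< P >] then
    \int[Q]_t lne (Radon_Nikodym (charge_of_finite_measure Q) P t)
  else +oo.

Definition argmin (C : set (probability Theta R))
    (J : probability Theta R -> \bar R) (Q : probability Theta R) : Prop :=
  C Q /\ forall Q', C Q' -> J Q <= J Q'.

End parametrization.

Section sequential.
Context {dO : measure_display} {Omega : measurableType dO}.
Variables (Pr : probability Omega R) (m : nat).
Variable Z : nat -> 'I_m -> {RV Pr >-> triple}.

(* <<s history k >> is generated by the batches S_0, ..., S_(k-1); it is the
   sigma-algebra F_(k-1), trivial for k = 0. *)
Definition history (k : nat) : set (set Omega) :=
  [set A | exists j : nat, exists i : 'I_m, exists B : set triple,
    [/\ (j < k)%N, measurable B & A = Z j i @^-1` B]].

(* Measurability with respect to F_(k-1), jointly in (omega, x), so that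
   integrals under nu x pi x p are themselves F_(k-1)-measurable. *)
Definition history_measurable (X : set (ctx R d)) (k : nat)
    (pi : Omega -> policy) : Prop :=
  forall a : 'I_K.+1,
    measurable_fun ([set: g_sigma_algebraType (history k)] `*` X)
      (fun z : g_sigma_algebraType (history k) * ctx R d => pi z.1 z.2 a).

(* Pr(Z_k,i in B_i for all i | F_(k-1)) = prod_i P(pi_k)(B_i), where the
   conditional probability is characterized by integration over F_(k-1). *)
Definition conditionally_iid (X : set (ctx R d)) (nu : probability (ctx R d) R)
    (p : R.-pker (ctx R d * 'I_K.+1)%type ~> R) (k : nat)
    (pi : Omega -> policy) : Prop :=
  forall (G : set Omega) (B : 'I_m -> set triple),
    <<s history k >> G -> (forall i, measurable (B i)) ->
    Pr (G `&` [set w | forall i, B i (Z k i w)]) =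
    \int[Pr]_(w in G) \prod_(i < m) law_policy X nu p (pi w) (B i).

Definition LS_risk (lambda : R) (pi : nat -> Omega -> policy) (k : nat)
    (w : Omega) (q : policy) : R :=
  (- ((k.+1 * m)%:R)^-1 * \sum_(j < k.+1) \sum_(i < m)
    (let: (x, a, c) := Z j i w in
     q x a / lambda * ln (1 - lambda * c / pi j w x a)))%R.

End sequential.
End bandit.

Arguments triple : clear implicits.
Arguments policy : clear implicits.

(* Main.v *)
Require Import Defs.
From HB Require Import structures.
From mathcomp Require Import all_boot all_order all_algebra.
From mathcomp Require Import all_classical all_reals all_analysis.
From mathcomp Require Import measurable_realfun measurable_fun_approximation.
From mathcomp Require Import ring lra.
Import Order.TTheory GRing.Theory Num.Theory.
Import numFieldNormedType.Exports.
Set Implicit Arguments.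
Unset Strict Implicit.
Unset Printing Implicit Defensive.
Local Open Scope classical_set_scope.
Local Open Scope ring_scope.
Local Open Scope ereal_scope.

(** Fix one finite measure [rho] on triples, with respect to which every law
    [P(pi)] has density [pi(a|x)], and put [v = lambda |c| / pi_j(a|x)].

    Upper bound: for a predictor [theta], [1{f_theta(x) = a} log (1 + v)] has
    exponential moment [1 + lambda |R_j(theta)|] under [P(pi_j)], where [R_j]
    only counts the actions that [pi_j] can play, so that [|R_j| <= |R|].  The
    products of [exp (lambda R(theta)) (1 + 1{f_theta(x) = a} v)] over the data
    are therefore supermartingales, as is their mixture under the prior.  The
    Donsker-Varadhan inequality turns a bound on the mixture into a bound on
    the risk of all posteriors at once, in particular of [Qhat].

    Lower bound: [Qstar] does not depend on the data, so no change of measure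
    is needed.  By convexity [exp (- q log (1 + v)) <= 1 - q v + q v^2], which
    bounds the exponential moment of minus the estimator by the risk of [Qstar]
    and its second moment.

    Ville's inequality for the sum of the two processes bounds both, uniformly
    in time, by [2 / delta]; optimality of [Qhat] then links the two bounds. *)

(** * Positive functionals *)

(** The penalty in the objective has the weight [1 / (lambda (k + 1) m)] that the change of measure
    produces, so [KL(Qhat, P)] cancels between the upper bound and optimality. What remains is
    [KL(Qstar, P) + 2 log (2 / delta)], one logarithm for each bound; nonnegativity of the
    divergence rounds this up to the stated form.

    The main obstacle is that conditional independence is only given for events: [G] in the past and
    fixed sets [B_i]. The factors of the supermartingales depend on the past as well, through
    [pi_k], and jointly with the new triple. The identity must first be extended to products of
    jointly measurable functions.

    Division by zero yields 0, so [v] vanishes wherever [pi_j] does. For the upper bound this only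
    discards nonnegative losses. For the lower bound it would discard part of the risk of [Qstar],
    and there coverage enters. *)

(* Iterated integrals with random weights are compared through these axioms
   rather than as measures; the pi-lambda theorem then applies to the measures
   representing them. *)
Record positive_functional d (T : measurableType d) (R : realType)
    (Phi : (T -> \bar R) -> \bar R) : Prop := PositiveFunctional {
  pf_ge0 : forall f : T -> \bar R, (forall x, 0 <= f x) -> measurable_fun setT f ->
    0 <= Phi f ;
  pf_add : forall f g : T -> \bar R, (forall x, 0 <= f x) -> measurable_fun setT f ->
    (forall x, 0 <= g x) -> measurable_fun setT g ->
    Phi (fun x => f x + g x) = Phi f + Phi g ;
  pf_scale : forall (c : R) (f : T -> \bar R), (0 <= c)%R -> (forall x, 0 <= f x) ->
    measurable_fun setT f -> Phi (fun x => c%:E * f x) = c%:E * Phi f ;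
  pf_mono : forall f : (T -> \bar R)^nat, (forall n x, 0 <= f n x) ->
    (forall n, measurable_fun setT (f n)) ->
    (forall x, {homo f ^~ x : a b / (a <= b)%N >-> a <= b}) ->
    Phi (fun x => limn (f ^~ x)) = limn (fun n => Phi (f n)) }.

Section positive_functional_theory.
Context d (T : measurableType d) (R : realType).
Implicit Types Phi : (T -> \bar R) -> \bar R.

Import HBNNSimple.

Lemma pf_0 Phi : positive_functional Phi -> Phi (cst 0) = 0.
Proof.
move=> HPhi.
have -> : cst 0 = (fun x : T => 0%:E * cst (0 : \bar R) x).
  by apply/funext => x; rewrite mul0e.
by rewrite pf_scale// mul0e.
Qed.

Lemma pf_sum Phi : positive_functional Phi ->
  forall (I : Type) (s : seq I) (f : I -> T -> \bar R),
  (forall i x, 0 <= f i x) -> (forall i, measurable_fun setT (f i)) ->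
  Phi (fun x => \sum_(i <- s) f i x) = \sum_(i <- s) Phi (f i).
Proof.
move=> HPhi I s f f0 mf; elim: s => [|i s IHs].
  under eq_fun do rewrite big_nil; rewrite big_nil; exact: pf_0.
under eq_fun do rewrite big_cons.
rewrite big_cons pf_add//; first by rewrite IHs.
- by move=> x; apply: sume_ge0.
- exact: emeasurable_sum.
Qed.

(** The axioms only control [Phi] on measurable functions, whereas a measure must be nonnegative on
    every set; the value 0 off the measurable sets provides this. *)
Let meas_of Phi (A : set T) := if `[< measurable A >] then Phi (fun x => (\1_A x)%:E) else 0.

(** The measure is [Phi] on indicators: monotone continuity gives sigma-additivity; equality then
    passes to simple functions by linearity and to their limits by monotone continuity again. *)
Lemma positive_functional_measure Phi : positive_functional Phi ->
  exists mu : {measure set T -> \bar R}, forall f : T -> \bar R,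
  (forall x, 0 <= f x) -> measurable_fun setT f -> Phi f = \int[mu]_x f x.
Proof.
move=> HPhi; pose m0 A := meas_of Phi A.
have mi A : measurable A -> measurable_fun setT (fun x : T => (\1_A x : R)%:E).
  by move=> mA; exact/measurable_EFinP/measurable_indic.
have m0E A : measurable A -> m0 A = Phi (fun x => (\1_A x)%:E).
  by move=> mA; rewrite /m0 /meas_of asboolT.
have m00 : m0 set0 = 0.
  rewrite m0E// -[RHS](pf_0 HPhi); congr Phi; apply/funext => x.
  by rewrite indic0.
have m0ge0 A : 0 <= m0 A.
  have [mA|mA] := pselect (measurable A).
    by rewrite m0E//; apply: (pf_ge0 HPhi); [move=> x; rewrite lee_fin|exact: mi].
  by rewrite /m0 /meas_of asboolF//= (pf_0 HPhi).
have m0s : semi_sigma_additive m0.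
  move=> F mF tF mUF.
  have cv : cvgn (fun n => \sum_(0 <= i < n) m0 (F i)).
    by apply: is_cvg_nneseries => n _ _; exact: m0ge0.
  rewrite m0E//.
  have -> : (fun x => (\1_(\bigcup_n F n) x)%:E) =
      (fun x => limn (fun n => \sum_(0 <= i < n) (\1_(F i) x : R)%:E)).
    by apply/funext => x; rewrite indic_bigcup.
  rewrite (pf_mono HPhi).
  - suff -> : (fun n => Phi (fun x => \sum_(0 <= i < n) (\1_(F i) x)%:E)) =
        (fun n => \sum_(0 <= i < n) m0 (F i)) by exact: cv.
    apply/funext => n; rewrite (pf_sum HPhi).
    + by apply: eq_bigr => i _; rewrite m0E.
    + by move=> i x; rewrite lee_fin.
    + by move=> i; exact: mi.
  - by move=> n x; apply: sume_ge0 => i _; rewrite lee_fin.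
  - by move=> n; apply: emeasurable_sum => i; exact: mi.
  - move=> x a b ab.
    have F0 i : 0 <= (\1_(F i) x : R)%:E by rewrite lee_fin.
    exact: lee_sum_nneg_natr.
pose MM := isMeasure.Build _ _ _ m0 m00 m0ge0 m0s.
pose mu : {measure set T -> \bar R} := HB.pack m0 MM.
exists mu => f f0 mf.
pose h := nnsfun_approx measurableT mf.
have fE : f = (fun x => limn (fun n => (h n x)%:E)).
  apply/funext => x; apply/esym/cvg_lim => //.
  exact: cvg_nnsfun_approx.
have hm n : measurable_fun setT (fun x => (h n x)%:E).
  exact/measurable_EFinP.
have hnd x : {homo (fun n => (h n x)%:E) : a b / (a <= b)%N >-> a <= b}.
  by move=> a b ab; rewrite lee_fin; exact/lefP/nd_nnsfun_approx.
have h0 n x : 0 <= (h n x)%:E by rewrite lee_fin.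
rewrite [in LHS]fE [in RHS]fE (pf_mono HPhi)// monotone_convergence//.
congr (limn _); apply/funext => n.
(* [pf_scale] needs nonnegative coefficients, hence the truncation at 0; for [y < 0] the preimage is
   empty because [h n] is nonnegative. *)
have hE : (fun x => (h n x)%:E) = (fun x => \sum_(y <- finmap.enum_fset (fset_set (range (h n))))
    (Num.max 0%R y)%:E * (\1_(h n @^-1` [set y]) x)%:E).
  apply/funext => x; rewrite (fimfunE (h n) x) fsbig_finite//= sumEFin.
  congr (_%:E); apply: eq_bigr => y _; rewrite /=.
  have [y0|y0] := leP 0%R y; first by [].
  rewrite mul0r indicE memNset ?mulr0//= => hxy.
  by have := h0 n x; rewrite hxy lee_fin leNgt y0.
have m1 y : measurable (h n @^-1` [set y]).
  by rewrite -[X in measurable X]setTI; exact: (measurable_funP (h n)).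
rewrite hE (pf_sum HPhi); last 2 first.
- by move=> y x; rewrite mule_ge0// lee_fin// le_max lexx.
- by move=> y; apply: emeasurable_funM => //; exact: mi.
rewrite ge0_integral_sum//; last 2 first.
- by move=> y; apply: emeasurable_funM => //; exact: mi.
- by move=> y x _; rewrite mule_ge0// lee_fin// le_max lexx.
apply: eq_bigr => y _.
have y0 : (0 <= Num.max 0 y)%R by rewrite le_max lexx.
have i0 x : 0 <= (\1_(h n @^-1` [set y]) x : R)%:E by rewrite lee_fin.
rewrite (pf_scale HPhi y0 i0 (mi _ (m1 y))).
rewrite (ge0_integralZl mu measurableT (mi _ (m1 y)) (fun x _ => i0 x)) ?lee_fin//.
by rewrite integral_indic// setIT -m0E.
Qed.

(** Both functionals are integrals, and the two measures agree on a generating pi-system containing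
    the whole space, whose mass is finite. *)
Lemma positive_functional_unique (G : set (set T)) Phi Psi :
  positive_functional Phi -> positive_functional Psi ->
  @measurable _ T = <<s G >> -> setI_closed G -> G setT ->
  (forall A, G A -> Phi (fun x => (\1_A x)%:E) = Psi (fun x => (\1_A x)%:E)) ->
  Phi (cst 1) < +oo ->
  forall f, (forall x, 0 <= f x) -> measurable_fun setT f -> Phi f = Psi f.
Proof.
move=> HPhi HPsi mG IG GT PG Phi1 f f0 mf.
have [mu muE] := positive_functional_measure HPhi.
have [nu nuE] := positive_functional_measure HPsi.
have mi A : measurable A -> measurable_fun setT (fun x : T => (\1_A x : R)%:E).
  by move=> mA; exact/measurable_EFinP/measurable_indic.
have GM : G `<=` measurable by rewrite mG; exact: sub_sigma_algebra.
have i0 A (x : T) : 0 <= (\1_A x : R)%:E by rewrite lee_fin.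
have muA A : measurable A -> mu A = Phi (fun x => (\1_A x)%:E).
  by move=> mA; rewrite muE ?integral_indic ?setIT//; exact: mi.
have nuA A : measurable A -> nu A = Psi (fun x => (\1_A x)%:E).
  by move=> mA; rewrite nuE ?integral_indic ?setIT//; exact: mi.
rewrite muE// nuE//; apply: eq_measure_integral => A mA _.
apply: (@g_sigma_algebra_measure_unique _ _ _ G GM (fun=> setT)) => //.
- by rewrite bigcup_const//; exists 0%N.
- by move=> B GB; rewrite muA ?nuA ?PG//; exact: GM.
- move=> _; rewrite muA//.
  by rewrite (_ : (fun x => _) = cst 1)//; apply/funext => x; rewrite indicT.
- by rewrite -mG.
Qed.

End positive_functional_theory.

Section positive_functional_instances.
Context (R : realType).

(** Once all other factors are frozen into a weight, each side of the product identity for a batch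
    has this form as a function of the remaining factor. *)
Lemma positive_functional_weighted d d' (Y : measurableType d)
    (T : measurableType d') (mu : {measure set Y -> \bar R}) (W : Y -> R)
    (phi : Y -> T) :
  (forall y, (0 <= W y)%R) -> measurable_fun setT W ->
  measurable_fun setT phi ->
  positive_functional (fun f => \int[mu]_y ((W y)%:E * f (phi y))).
Proof.
move=> W0 mW mphi.
have mWf f : measurable_fun setT f ->
    measurable_fun setT (fun y => (W y)%:E * f (phi y)).
  move=> mf; apply: emeasurable_funM; first exact/measurable_EFinP.
  exact: measurableT_comp.
have W0f f : (forall x, 0 <= f x) -> forall y, 0 <= (W y)%:E * f (phi y).
  by move=> f0 y; rewrite mule_ge0// lee_fin.
split.
- by move=> f f0 mf; apply: integral_ge0 => y _; exact: W0f.
- move=> f g f0 mf g0 mg; rewrite -ge0_integralD//.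
  + by apply: eq_integral => y _; rewrite ge0_muleDr.
  + by move=> y _; exact: W0f.
  + exact: mWf.
  + by move=> y _; exact: W0f.
  + exact: mWf.
- move=> c f c0 f0 mf; rewrite -ge0_integralZl ?lee_fin//.
  + by apply: eq_integral => y _; rewrite muleCA.
  + exact: mWf.
  + by move=> y _; exact: W0f.
- move=> f f0 mf fnd; rewrite -monotone_convergence//.
  + apply: eq_integral => y _; apply/esym/cvg_lim => //.
    apply: cvgeZl => //; apply: ereal_nondecreasing_is_cvgn => a b ab.
    exact: fnd.
  + by move=> n; exact: mWf.
  + by move=> n y _; exact: W0f.
  + by move=> y _ a b ab; apply: lee_wpmul2l; [rewrite lee_fin|exact: fnd].
Qed.

End positive_functional_instances.

(** * Conditionally independent batches *)

Section sub_sigma_algebra.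
Context d (Omega : measurableType d) (H : set (set Omega)).
Hypothesis HM : H `<=` measurable.

Lemma sigma_algebra_sub_measurable : <<s H >> `<=` measurable.
Proof. exact: smallest_sub (@sigma_algebra_measurable _ Omega) HM. Qed.

Lemma measurable_fun_sub_sigma d' (T : measurableType d') D
    (g : g_sigma_algebraType H -> T) :
  measurable (D : set (g_sigma_algebraType H)) ->
  measurable_fun D g -> measurable_fun (D : set Omega) (g : Omega -> T).
Proof.
by move=> mD mg _ B mB; apply: sigma_algebra_sub_measurable; exact: mg.
Qed.

Lemma measurable_id_sub_sigma :
  measurable_fun [set: Omega] (id : Omega -> g_sigma_algebraType H).
Proof.
by move=> _ B mB; rewrite setTI; exact: sigma_algebra_sub_measurable.
Qed.

End sub_sigma_algebra.

Lemma indic_forall (R : realType) (I : finType) (T : Type) (A : I -> set T) x :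
  \1_[set y | forall i, A i y] x = (\prod_i \1_(A i) x)%R :> R.
Proof.
have [xA|/existsNP[i Aix]] := pselect (forall i, A i x).
  by rewrite indicE mem_set// big1// => i _; rewrite indicE mem_set.
rewrite indicE memNset; last by move=> /(_ i).
by rewrite (bigD1 i)//= indicE memNset// mul0r.
Qed.

Lemma emeasurable_prod d (T : measurableType d) (R : realType) (D : set T)
    (I : Type) (s : seq I) (f : I -> T -> \bar R) :
  (forall i, measurable_fun D (f i)) ->
  measurable_fun D (fun x => \prod_(i <- s) f i x).
Proof.
move=> mf; elim: s => [|i s IHs].
  rewrite (_ : (fun _ => _) = cst 1)//.
  by apply/funext => x; rewrite big_nil.
by under eq_fun do rewrite big_cons; exact: emeasurable_funM.
Qed.

Lemma lee_prod (R : realDomainType) (I : Type) (s : seq I)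
    (f g : I -> \bar R) :
  (forall i, 0 <= f i <= g i) -> \prod_(i <- s) f i <= \prod_(i <- s) g i.
Proof.
move=> fg; suff /andP[] : 0 <= \prod_(i <- s) f i <= \prod_(i <- s) g i by [].
elim: s => [|i s /andP[IH0 IH]]; first by rewrite !big_nil lexx andbT.
rewrite !big_cons; have /andP[fi0 fgi] := fg i.
by rewrite mule_ge0//= lee_pmul.
Qed.

Lemma prode_ge0 (R : realDomainType) (I : Type) (s : seq I) (f : I -> \bar R) :
  (forall i, 0 <= f i) -> 0 <= \prod_(i <- s) f i.
Proof. by move=> f0; elim/big_ind : _ => //; exact: mule_ge0. Qed.

Section conditional_product.
Context d d' (R : realType) (Omega : measurableType d) (T : measurableType d').
Variables (Pr : probability Omega R) (H : set (set Omega)).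
Hypothesis HM : H `<=` measurable.
Local Notation OH := (g_sigma_algebraType H).
Variables (rho : {finite_measure set T -> \bar R}) (p : OH * T -> R).
Hypotheses (p0 : forall x, (0 <= p x)%R) (mp : measurable_fun setT p).
Hypothesis p1 : forall w, \int[rho]_z (p (w, z))%:E <= 1.

(** When [p (w, z)] is the conditional density of [Z i] given [<<s H>>], this is a version of the
    conditional expectation of [g (w, Z i w)]. *)
Definition density_integral (g : OH * T -> \bar R) (w : OH) : \bar R :=
  \int[rho]_z ((p (w, z))%:E * g (w, z)).

Local Notation K := density_integral.

Lemma density_integral_ge0 g w : (forall x, 0 <= g x) -> 0 <= K g w.
Proof. by move=> g0; apply: integral_ge0 => z _; rewrite mule_ge0// lee_fin. Qed.

Lemma measurable_density_integral g : (forall x, 0 <= g x) ->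
  measurable_fun setT g -> measurable_fun setT (K g).
Proof.
move=> g0 mg.
apply: (measurable_fun_fubini_tonelli_F (m2 := rho)
  (fun x : OH * T => (p x)%:E * g x)).
- by apply: emeasurable_funM => //; exact/measurable_EFinP.
- by move=> x; rewrite mule_ge0// lee_fin.
Qed.

Lemma density_integral_le g w c : (0 <= c)%R -> (forall x, 0 <= g x) ->
  measurable_fun setT g -> (forall x, g x <= c%:E) -> K g w <= c%:E.
Proof.
move=> c0 g0 mg gc.
have mpw : measurable_fun setT (fun z => (p (w, z))%:E).
  by apply/measurable_EFinP; exact: measurableT_comp.
have mgw : measurable_fun setT (fun z => g (w, z)).
  exact: measurableT_comp.
apply: (@le_trans _ _ (\int[rho]_z (c%:E * (p (w, z))%:E))).
  apply: ge0_le_integral => //.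
  - by move=> z _; rewrite mule_ge0// lee_fin.
  - exact: emeasurable_funM.
  - exact: emeasurable_funM.
  - by move=> z _; rewrite muleC lee_wpmul2r// lee_fin.
rewrite ge0_integralZl ?lee_fin//; last by move=> z _; rewrite lee_fin.
by rewrite -[leRHS]mule1 lee_wpmul2l// lee_fin.
Qed.

Variables (m : nat) (Z : 'I_m -> Omega -> T).
Hypothesis mZ : forall i, measurable_fun setT (Z i).
Hypothesis Ziid : forall (G : set Omega) (B : 'I_m -> set T),
  <<s H >> G -> (forall i, measurable (B i)) ->
  Pr (G `&` [set w | forall i, B i (Z i w)]) =
  \int[Pr]_(w in G) \prod_(i < m) \int[rho]_z ((p (w, z))%:E * (\1_(B i) z)%:E).

Let measurable_section (w : OH) (g : OH * T -> R) : measurable_fun setT g ->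
  measurable_fun setT (fun z => g (w, z)).
Proof. by move=> mg; exact: measurableT_comp. Qed.

Let measurable_on_Omega (g : OH * T -> R) : measurable_fun setT g ->
  measurable_fun [set: Omega * T] (g : Omega * T -> R).
Proof.
move=> mg; pose phi (x : Omega * T) : OH * T := (x.1, x.2).
rewrite (_ : g = g \o phi :> (Omega * T -> R)); last by apply/funext => -[].
apply: (measurableT_comp mg).
apply: measurable_fun_pair => //=.
exact: (measurableT_comp (measurable_id_sub_sigma HM) measurable_fst).
Qed.

Let rect : set (set (OH * T)) :=
  [set A `*` B | A in @measurable _ OH & B in @measurable _ T].

Let mhZ (g : OH * T -> R) i : measurable_fun setT g ->
  measurable_fun [set: Omega] (fun w => g (w, Z i w)).
Proof.
move=> mg; apply: (measurableT_comp mg).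
by apply: measurable_fun_pair => //; exact: measurable_id_sub_sigma.
Qed.

(** On rectangles, the [omega]-parts of all factors gather into a single event [G] of the past; what
    is left is the hypothesis of conditional independence. *)
Let prod_rect (h : 'I_m -> OH * T -> R) :
  (forall i, exists2 C, rect C & h i = \1_C) ->
  \int[Pr]_w \prod_(i < m) (h i (w, Z i w))%:E =
  \int[Pr]_w \prod_(i < m) K (EFin \o h i) w.
Proof.
move=> hC.
have /choice[A hA] i : exists AB : set OH * set T,
    [/\ measurable AB.1, measurable AB.2 & h i = \1_(AB.1 `*` AB.2)].
  by have [C [A mA [B mB <-]] ->] := hC i; exists (A, B).
have hE i w z : h i (w, z) = (\1_((A i).1) w * \1_((A i).2) z)%R.
  by have [_ _ ->] := hA i; rewrite !indicE in_setX -mulnb natrM.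
pose G : set Omega := [set w | forall i, (A i).1 w].
have mG : <<s H >> G.
  rewrite (_ : G = \bigcap_(i in [set: 'I_m]) (A i).1).
    by apply: (@fin_bigcap_measurable _ OH) => // i _; have [] := hA i.
  by apply/seteqP; split=> [w wA i _|w wA i]; exact: wA.
transitivity (Pr (G `&` [set w | forall i, (A i).2 (Z i w)])).
  have mE : measurable (G `&` [set w | forall i, (A i).2 (Z i w)]).
    apply: measurableI; first exact: (sigma_algebra_sub_measurable HM mG).
    rewrite (_ : [set w | _] = \bigcap_(i in [set: 'I_m]) (Z i @^-1` (A i).2)).
      apply: fin_bigcap_measurable => // i _; rewrite -[X in measurable X]setTI.
      by apply: mZ => //; have [] := hA i.
    by apply/seteqP; split=> [w wA i _|w wA i]; exact: wA.
  rewrite -[in RHS](setIT (_ `&` _)) -integral_indic//; apply: eq_integral => w _.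
  rewrite indicI/= (indic_forall _ (fun i => (A i).1)).
  rewrite (indic_forall _ (fun i w => (A i).2 (Z i w))) -big_split/= prodEFin.
  by congr (_%:E); apply: eq_bigr => i _; rewrite hE.
rewrite (Ziid (B := fun i => (A i).2) mG); last by move=> i; have [] := hA i.
rewrite integral_mkcond; apply: eq_integral => w _.
rewrite epatch_indic/= (indic_forall _ (fun i => (A i).1)) -prodEFin muleC.
rewrite -big_split/=; apply: eq_bigr => i _; rewrite /K.
rewrite -ge0_integralZl ?lee_fin//; last 2 first.
- apply: emeasurable_funM.
    by apply/measurable_EFinP; exact: (measurable_section w mp).
  by apply/measurable_EFinP/measurable_indic; have [] := hA i.
- by move=> z _; rewrite mule_ge0// lee_fin.
by apply: eq_integral => z _; rewrite /= hE EFinM muleCA.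
Qed.

(* By induction on the number of factors that are not indicators of rectangles:
   the other factors being fixed, both sides are positive functionals of the
   n-th one, and they agree on rectangles. *)
Lemma conditional_product_bounded (h : 'I_m -> OH * T -> R) c :
  (forall i x, (0 <= h i x <= c)%R) -> (forall i, measurable_fun setT (h i)) ->
  \int[Pr]_w \prod_(i < m) (h i (w, Z i w))%:E =
  \int[Pr]_w \prod_(i < m) K (EFin \o h i) w.
Proof.
pose M (n : nat) := forall (h : 'I_m -> OH * T -> R) (c : R),
  (0 <= c)%R ->
  (forall i x, (0 <= h i x <= c)%R) -> (forall i, measurable_fun setT (h i)) ->
  (forall i : 'I_m, (n <= i)%N -> exists2 C, rect C & h i = \1_C) ->
  \int[Pr]_w \prod_(i < m) (h i (w, Z i w))%:E =
  \int[Pr]_w \prod_(i < m) K (EFin \o h i) w.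
suff : forall n, (n <= m)%N -> M n.
  move=> /(_ m (leqnn m)) Mm hc mh.
  have cp : (c <= Num.max 0 c)%R by rewrite le_max lexx orbT.
  apply: (Mm h (Num.max 0 c)%R) => //; first by rewrite le_max lexx.
    by move=> i x; have /andP[-> /= hic] := hc i x; exact: le_trans hic cp.
  by move=> i; rewrite leqNgt ltn_ord.
elim=> [_ {}h {}c c0 hc mh hr|n IHn nm {}h {}c c0 hc mh hr].
  by apply: prod_rect => i; exact: hr.
pose i0 := Ordinal nm.
(* The other factors are frozen: [W1] evaluates them at the data, [W2] replaces them by their
   conditional expectations. *)
pose W1 w := (\prod_(i < m | i != i0) h i (w, Z i w))%R.
pose W2 w := (\prod_(i < m | i != i0) fine (K (EFin \o h i) w))%R.
have h0 i x : (0 <= h i x)%R by have /andP[] := hc i x.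
have mhE i : measurable_fun setT (EFin \o h i) by exact/measurable_EFinP.
have Kfin i w : K (EFin \o h i) w \is a fin_num.
  rewrite ge0_fin_numE; last by apply: density_integral_ge0 => x; rewrite lee_fin.
  apply: le_lt_trans (ltry c); apply: density_integral_le => //.
  - by move=> x; rewrite lee_fin.
  - by move=> x; rewrite lee_fin; have /andP[] := hc i x.
have W1_ge0 w : (0 <= W1 w)%R by apply: prodr_ge0.
have W2_ge0 w : (0 <= W2 w)%R.
  apply: prodr_ge0 => i _; apply: fine_ge0; apply: density_integral_ge0 => x.
  by rewrite lee_fin.
have mW1 : measurable_fun setT W1.
  rewrite /W1; under eq_fun do rewrite -big_filter.
  by apply: measurable_prod => i _; exact: mhZ.
have mW2 : measurable_fun [set: Omega] W2.
  rewrite /W2; under eq_fun do rewrite -big_filter.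
  apply: measurable_prod => i _; apply: measurableT_comp => //.
  apply: (@measurable_fun_sub_sigma _ _ H) => //.
  by apply: measurable_density_integral => // x; rewrite lee_fin.
pose Phi (g : OH * T -> \bar R) := \int[Pr]_w ((W1 w)%:E * g (w, Z i0 w)).
(* Over the product measure, the integral against the density becomes a weighted functional as
   well. *)
pose Psi (g : OH * T -> \bar R) :=
  \int[Pr \x rho]_x ((W2 x.1 * p x)%:E * g (x.1 : OH, x.2)).
have PhiE (g : OH * T -> R) : (forall x, (0 <= g x)%R) ->
    \int[Pr]_w \prod_(i < m) ((fun i => if i == i0 then g else h i) i (w, Z i w))%:E
    = Phi (EFin \o g).
  move=> g0; apply: eq_integral => w _.
  rewrite (bigD1 i0)//= eqxx muleC /W1 -prodEFin; congr (_ * _).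
  by apply: eq_bigr => i /negbTE ->.
have PsiE (g : OH * T -> R) : (forall x, (0 <= g x)%R) -> measurable_fun setT g ->
    \int[Pr]_w \prod_(i < m) K (EFin \o (fun i => if i == i0 then g else h i) i) w
    = Psi (EFin \o g).
  move=> g0 mg; rewrite /Psi.
  have mp' := measurable_on_Omega mp.
  have mg' : measurable_fun [set: Omega * T] (fun x => g (x.1 : OH, x.2)).
    rewrite (_ : (fun x => _) = g :> (Omega * T -> R)).
      exact: measurable_on_Omega.
    by apply/funext => -[].
  rewrite fubini_tonelli1; last 2 first.
  - apply: emeasurable_funM; apply/measurable_EFinP => //.
    by apply: measurable_funM => //; exact: measurableT_comp.
  - by move=> x; rewrite mule_ge0// lee_fin// mulr_ge0.
  apply: eq_integral => w _; rewrite /fubini_F/= (bigD1 i0)//= eqxx muleC.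
  under [RHS]eq_integral do rewrite EFinM -muleA.
  rewrite ge0_integralZl ?lee_fin//; last 2 first.
  - by apply: emeasurable_funM; apply/measurable_EFinP; exact: measurable_section.
  - by move=> z _; rewrite mule_ge0// lee_fin.
  congr (_ * _); rewrite /W2 -prodEFin; apply: eq_bigr => i /negbTE ->.
  by rewrite fineK.
have hE : h = (fun i => if i == i0 then h i0 else h i).
  by apply/funext => i; case: eqP => // ->.
rewrite hE PhiE// PsiE//.
apply: (positive_functional_unique (G := rect)) => //.
- by apply: (@positive_functional_weighted R _ _ Omega (OH * T)%type Pr W1
      (fun w => (w : OH, Z i0 w)));
    [|exact: mW1|apply: measurable_fun_pair => //; exact: measurable_id_sub_sigma].
- apply: (@positive_functional_weighted R _ _ (Omega * T)%type (OH * T)%type (Pr \x rho)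
    (fun x => W2 x.1 * p x)%R (fun x => (x.1 : OH, x.2))).
  + by move=> x; rewrite mulr_ge0.
  + by apply: measurable_funM;
      [exact: measurableT_comp|exact: measurable_on_Omega].
  + apply: measurable_fun_pair => //=.
    exact: (measurableT_comp (measurable_id_sub_sigma HM) measurable_fst).
- exact: measurable_prod_measurableType.
- move=> _ _ [A1 mA1 [B1 mB1 <-]] [A2 mA2 [B2 mB2 <-]].
  exists (A1 `&` A2); first exact: measurableI.
  by exists (B1 `&` B2); [exact: measurableI|rewrite setXI].
- by exists setT => //; exists setT => //; rewrite setXTT.
- move=> C rC.
  have mC : measurable_fun setT (\1_C : OH * T -> R).
    by have [A mA [B mB <-]] := rC; apply: measurable_indic; exact: measurableX.
  rewrite -/(EFin \o \1_C) -PhiE// -PsiE//.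
  pose h' (i : 'I_m) : OH * T -> R := if i == i0 then \1_C else h i.
  (* The bound [c] may be below the indicator that replaces the factor [i0], hence the maximum with
     1. *)
  have := IHn (ltnW nm) h' (Num.max c 1)%R; rewrite /h'; apply.
  + by rewrite le_max c0.
  + move=> i x; case: eqP => _; rewrite le_max.
      by rewrite !indicE; case: (_ \in _); rewrite ?lexx ?ler01 ?orbT.
    by have /andP[-> ->] := hc i x.
  + by move=> i; case: eqP.
  + move=> i ni; case: eqP => [_|/eqP ii0]; first by exists C.
    by apply: hr; rewrite ltn_neqAle ni andbT eq_sym; exact: contra ii0.
- apply: (@le_lt_trans _ _ (\int[Pr]_w (\prod_(i < m | i != i0) c)%R%:E)).
    apply: ge0_le_integral => //.
    + by move=> w _; rewrite mule_ge0// lee_fin.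
    + by apply: emeasurable_funM => //; exact/measurable_EFinP.
    + by move=> w _; rewrite mule1 lee_fin; exact: ler_prod.
  by rewrite integral_cst//= probability_setT mule1 ltry.
- by move=> x; rewrite lee_fin.
Qed.

(** Truncation at [n] reduces to the bounded case. Monotone convergence is used on the left only; on
    the right each truncated conditional expectation is at most the full one, and an inequality is
    all that a supermartingale requires. *)
Lemma conditional_product_le (h : 'I_m -> OH * T -> R) :
  (forall i x, (0 <= h i x)%R) -> (forall i, measurable_fun setT (h i)) ->
  \int[Pr]_w \prod_(i < m) (h i (w, Z i w))%:E <=
  \int[Pr]_w \prod_(i < m) K (EFin \o h i) w.
Proof.
move=> h0 mh.
pose hn n i x := Num.min (h i x) n%:R.
have hn0 n i x : (0 <= hn n i x)%R by rewrite /hn le_min h0 ler0n.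
have hnh n i x : (hn n i x <= h i x)%R by rewrite /hn ge_min lexx.
have mhn n i : measurable_fun setT (hn n i).
  exact: measurable_minr.
have mhnZ n : measurable_fun [set: Omega] (fun w => (\prod_(i < m) hn n i (w, Z i w))%:E).
  apply/measurable_EFinP; apply: measurable_prod => i _; exact: mhZ.
have cvgh w : (\prod_(i < m) hn n i (w, Z i w))%:E @[n --> \oo] -->
    \prod_(i < m) (h i (w, Z i w))%:E.
  (* There are finitely many real factors: at a fixed [w] the truncation is inactive from some [N]
     on. *)
  rewrite prodEFin; apply: cvg_near_cst.
  have [N hN] : exists N, forall i, (h i (w, Z i w) <= N%:R)%R.
    exists (\max_(i < m) (Num.truncn (h i (w, Z i w))).+1)%N => i.
    apply: le_trans (ltW (truncnS_gt _)) _; rewrite ler_nat.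
    exact: (leq_bigmax_cond (F := fun i => (Num.truncn (h i (w, Z i w))).+1)).
  exists N => // n /= Nn; congr (_%:E); apply: eq_bigr => i _; apply/min_idPl.
  by rewrite (le_trans (hN i))// ler_nat.
have -> : \int[Pr]_w \prod_(i < m) (h i (w, Z i w))%:E =
    limn (fun n => \int[Pr]_w (\prod_(i < m) hn n i (w, Z i w))%:E).
  rewrite -monotone_convergence//.
  - by apply: eq_integral => w _; apply/esym/cvg_lim => //; exact: cvgh.
  - by move=> n w _; rewrite lee_fin; apply: prodr_ge0.
  - move=> w _ a b ab; rewrite lee_fin; apply: ler_prod => i _.
    rewrite hn0 /= /hn le_min ge_min lexx/= ge_min.
    by rewrite ler_nat ab orbT.
apply: lime_le.
  apply: ereal_nondecreasing_is_cvgn => a b ab; apply: ge0_le_integral => //.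
  - by move=> w _; rewrite lee_fin; apply: prodr_ge0.
  - move=> w _; rewrite lee_fin; apply: ler_prod => i _.
    rewrite hn0 /= /hn le_min ge_min lexx/= ge_min.
    by rewrite ler_nat ab orbT.
apply: nearW => n.
under eq_integral do rewrite -prodEFin.
have hn_le i x : (0 <= hn n i x <= n%:R)%R by rewrite hn0 /hn ge_min lexx orbT.
rewrite (conditional_product_bounded hn_le)//.
have mK (g : OH * T -> R) : (forall x, 0 <= g x)%R -> measurable_fun setT g ->
    measurable_fun [set: Omega] (K (EFin \o g)).
  move=> g0 mg; apply: (@measurable_fun_sub_sigma _ _ H) => //.
  by apply: measurable_density_integral; [move=> x; rewrite lee_fin|exact/measurable_EFinP].
have K0 (g : OH * T -> R) w : (forall x, 0 <= g x)%R -> 0 <= K (EFin \o g) w.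
  by move=> g0; apply: density_integral_ge0 => x; rewrite lee_fin.
apply: ge0_le_integral => //.
- by move=> w _; apply: prode_ge0 => i; exact: K0.
- by apply: emeasurable_prod => i; exact: mK.
- by apply: emeasurable_prod => i; exact: mK.
move=> w _; apply: lee_prod => i; rewrite K0//=.
have mp_ : measurable_fun setT (fun z => (p (w, z))%:E).
  exact/measurable_EFinP/measurable_section.
apply: ge0_le_integral => //.
- by move=> z _; rewrite mule_ge0// lee_fin.
- by apply: emeasurable_funM => //; apply/measurable_EFinP; exact: measurable_section.
- by apply: emeasurable_funM => //; apply/measurable_EFinP; exact: measurable_section.
- by move=> z _; apply: lee_wpmul2l; rewrite lee_fin.
Qed.

End conditional_product.

(** * Supermartingales *)

Section maximal_inequality.
Context d (Omega : measurableType d) (R : realType) (Pr : probability Omega R).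
Variable H : nat -> set (set Omega).
Hypotheses (HM : forall k, H k `<=` measurable)
  (Hmono : forall k, H k `<=` H k.+1).
Variable U : nat -> Omega -> \bar R.
Hypotheses (U0 : forall k w, 0 <= U k w)
  (mU : forall k, measurable_fun setT (U k : g_sigma_algebraType (H k) -> \bar R))
  (Ustep : forall k G, <<s H k >> G ->
     \int[Pr]_(w in G) U k.+1 w <= \int[Pr]_(w in G) U k w).

(* [c Pr(B_n) + E[U_n; B_n^c]] is nonincreasing in [n], where [B_n] is the event
   that [U] reaches [c] before time [n]. *)
Lemma ville_inequality (c : R) : (0 < c)%R ->
  c%:E * Pr (\bigcup_k [set w | c%:E <= U k w]) <= \int[Pr]_w U 0%N w.
Proof.
move=> c0; pose A k := [set w | c%:E <= U k w].
have sA k : <<s H k >> (A k).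
  have := @emeasurable_fun_c_infty _ _ _ _
    (U k : g_sigma_algebraType (H k) -> \bar R) measurableT (@mU k) c%:E.
  by rewrite setTI.
have mA k : measurable (A k) by exact: (sigma_algebra_sub_measurable (@HM k) (sA k)).
have mUO k : measurable_fun [set: Omega] (U k).
  exact: (@measurable_fun_sub_sigma _ _ (H k) (@HM k)).
pose B n := \big[setU/set0]_(k < n) A k.
have sB n : <<s H n >> (B n).
  elim: n => [|n IHn]; rewrite /B; first by rewrite big_ord0; exact: sigma_algebra0.
  rewrite big_ord_recr/=; apply: (sub_sigma_algebra2 (@Hmono n)).
  exact: (@measurableU _ (g_sigma_algebraType (H n)) _ _ IHn (sA n)).
(* [B n.+1] involves [U] only up to time [n], so it is known one step before its index; this lets
   [Ustep] be applied at time [n] on its complement. *)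
have sB' n : <<s H n >> (B n.+1).
  rewrite /B big_ord_recr/=.
  exact: (@measurableU _ (g_sigma_algebraType (H n)) _ _ (sB n) (sA n)).
have mB n : measurable (B n) by exact: (sigma_algebra_sub_measurable (@HM n) (sB n)).
have BE n : B n.+1 = B n `|` (A n `\` B n).
  by rewrite /B big_ord_recr/= setUDr setDv setD0.
have step n : c%:E * Pr (B n) + \int[Pr]_(w in ~` B n) U n w <= \int[Pr]_w U 0%N w.
  elim: n => [|n IHn].
    by rewrite /B big_ord0 measure0 mule0 add0e setC0.
  apply: le_trans IHn.
  (* Either [U] first reaches [c] at time [n], where the constant [c] is at most [U n], or it has
     not reached it yet and the supermartingale inequality applies. *)
  have -> : ~` B n = (A n `\` B n) `|` ~` B n.+1.
    rewrite BE; apply/seteqP; split=> [w /= nB|w [[]//|/= /not_orP[]//]].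
    by have [wA|wA] := pselect (A n w); [left|right; move=> [|[]]].
  have mAB : measurable (A n `\` B n) by exact: measurableD.
  rewrite ge0_integral_setU//; last 3 first.
  - exact: measurableC.
  - exact: measurable_funTS.
  - rewrite disj_set2E; apply/eqP/seteqP; split => // w [[Aw nBw]].
    by rewrite BE /=; tauto.
  rewrite BE measureU//; last first.
    by apply/seteqP; split => // w [Bw [_]].
  rewrite -BE ge0_muleDr// -addeA; apply: leeD2l; apply: leeD.
    rewrite -integral_cst//; apply: ge0_le_integral => //.
    + by move=> w _; rewrite lee_fin ltW.
    + exact: measurable_funTS.
    + by move=> w [].
  by apply: Ustep; apply: (@measurableC _ (g_sigma_algebraType (H n))); exact: sB'.
have cvgB : Pr (B n) @[n --> \oo] --> Pr (\bigcup_k A k).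
  rewrite (_ : \bigcup_k A k = \bigcup_n B n); last first.
    apply/seteqP; split=> [w [k _ Akw]|w [n _]].
      by exists k.+1 => //; rewrite /B big_ord_recr/=; right.
    by rewrite /B -bigcup_mkord => -[k kn Akw]; exists k.
  apply: nondecreasing_cvg_mu => //.
    exact: bigcup_measurable.
  by move=> a b ab; apply/subsetPset; exact: subset_bigsetU.
have cvgcB : c%:E * Pr (B n) @[n --> \oo] --> c%:E * Pr (\bigcup_k A k).
  by apply: cvgeZl.
rewrite -(cvg_lim _ cvgcB)//; apply: lime_le; first by apply/cvg_ex; eexists; exact: cvgcB.
apply: nearW => n; apply: le_trans (step n).
by rewrite leeDl// integral_ge0.
Qed.

End maximal_inequality.

(** * Mixtures of products of factors with conditional mean at most one *)

Section likelihood_process.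
Context d d' dP (R : realType) (Omega : measurableType d)
  (T : measurableType d') (Par : measurableType dP).
Variables (Pr : probability Omega R) (mu : probability Par R).
Variable H : nat -> set (set Omega).
Hypotheses (HM : forall k, H k `<=` measurable)
  (Hmono : forall j k, (j <= k)%N -> H j `<=` H k).
Local Notation OH k := (g_sigma_algebraType (H k)).
Variables (rho : {finite_measure set T -> \bar R}).
Variable p : nat -> Omega -> T -> R.
Hypotheses (p0 : forall k w z, (0 <= p k w z)%R)
  (mp : forall k, measurable_fun setT (fun x : OH k * T => p k x.1 x.2)).
Hypothesis p1 : forall k w, \int[rho]_z (p k w z)%:E <= 1.
Variables (m : nat) (Z : nat -> 'I_m -> Omega -> T).
Hypothesis m_gt0 : (0 < m)%N.
Hypothesis mZ : forall k i, measurable_fun setT (Z k i).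
Hypothesis Zadapted : forall j k i, (j < k)%N ->
  measurable_fun setT (Z j i : OH k -> T).
Hypothesis Ziid : forall k (G : set Omega) (B : 'I_m -> set T),
  <<s H k >> G -> (forall i, measurable (B i)) ->
  Pr (G `&` [set w | forall i, B i (Z k i w)]) =
  \int[Pr]_(w in G) \prod_(i < m) \int[rho]_z ((p k w z)%:E * (\1_(B i) z)%:E).
Variable h : nat -> Par -> Omega -> T -> R.
Hypotheses (h0 : forall k t w z, (0 <= h k t w z)%R)
  (mh : forall k, measurable_fun setT
    (fun x : Par * (OH k * T) => h k x.1 x.2.1 x.2.2))
  (h1 : forall k t w, \int[rho]_z ((p k w z)%:E * (h k t w z)%:E) <= 1).

Definition likelihood k (t : Par) (w : Omega) : R :=
  (\prod_(j < k) \prod_(i < m) h j t w (Z j i w))%R.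

Definition mixture_likelihood k (w : Omega) : \bar R :=
  \int[mu]_t (likelihood k t w)%:E.

Lemma likelihood_ge0 k t w : (0 <= likelihood k t w)%R.
Proof. by apply: prodr_ge0 => j _; apply: prodr_ge0. Qed.

Lemma mixture_likelihood_ge0 k w : 0 <= mixture_likelihood k w.
Proof. by apply: integral_ge0 => t _; rewrite lee_fin likelihood_ge0. Qed.

Lemma mixture_likelihood0 w : mixture_likelihood 0 w = 1.
Proof.
rewrite /mixture_likelihood /likelihood.
under eq_integral do rewrite big_ord0.
by rewrite integral_cst//= probability_setT mul1e.
Qed.

Lemma measurable_likelihood k : measurable_fun setT
  (fun x : OH k * Par => likelihood k x.2 x.1).
Proof.
apply: measurable_prod => j _; apply: measurable_prod => i _.
pose phi (x : OH k * Par) : Par * (OH j * T) := (x.2, (x.1 : OH j, Z j i x.1)).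
rewrite (_ : (fun _ => _) = (fun x : Par * (OH j * T) => h j x.1 x.2.1 x.2.2) \o phi)//.
apply: measurableT_comp => //; apply: measurable_fun_pair => //=.
apply: measurable_fun_pair => /=.
  have mid : measurable_fun setT (id : OH k -> OH j).
    move=> _ B mB; rewrite setTI.
    by apply: (sub_sigma_algebra2 (Hmono (ltnW (ltn_ord j)))); exact: mB.
  exact: (measurableT_comp mid measurable_fst).
exact: (measurableT_comp (Zadapted i (ltn_ord j)) measurable_fst).
Qed.

Lemma measurable_likelihood_Omega k : measurable_fun setT
  (fun x : Omega * Par => likelihood k x.2 x.1).
Proof.
pose phi (x : Omega * Par) : OH k * Par := (x.1, x.2).
have mphi : measurable_fun setT phi.
  apply: measurable_fun_pair => //=.
  exact: (measurableT_comp (measurable_id_sub_sigma (@HM k)) measurable_fst).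
exact: (measurableT_comp (@measurable_likelihood k) mphi).
Qed.

Lemma measurable_mixture_likelihood k :
  measurable_fun setT (mixture_likelihood k : OH k -> \bar R).
Proof.
apply: (measurable_fun_fubini_tonelli_F (m2 := mu)
  (fun x : OH k * Par => (likelihood k x.2 x.1)%:E)).
  by apply/measurable_EFinP; exact: measurable_likelihood.
by move=> x; rewrite lee_fin likelihood_ge0.
Qed.

(** Tonelli exchanges the prior with the expectation, so the parameter can be fixed. Then the past
    likelihood is known at time [k] and the new batch contributes factors of conditional mean at
    most 1. *)
Lemma mixture_likelihood_step k G : <<s H k >> G ->
  \int[Pr]_(w in G) mixture_likelihood k.+1 w <=
  \int[Pr]_(w in G) mixture_likelihood k w.
Proof.
move=> sG; have mG := sigma_algebra_sub_measurable (@HM k) sG.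
have m1G : measurable_fun setT (\1_G : Omega -> R) by exact: measurable_indic.
have mF j : measurable_fun setT (fun x : Omega * Par => (\1_G x.1 * likelihood j x.2 x.1)%:E).
  apply/measurable_EFinP; apply: measurable_funM.
    exact: (measurableT_comp m1G measurable_fst).
  exact: measurable_likelihood_Omega.
have F0 j x : 0 <= (\1_G x.1 * likelihood j x.2 x.1)%:E.
  by rewrite lee_fin mulr_ge0// likelihood_ge0.
have swap j : \int[Pr]_(w in G) mixture_likelihood j w =
    \int[mu]_t \int[Pr]_w (\1_G w * likelihood j t w)%:E.
  rewrite integral_mkcond.
  transitivity (\int[Pr]_w \int[mu]_t (\1_G w * likelihood j t w)%:E).
    apply: eq_integral => w _; rewrite epatch_indic/= muleC -ge0_integralZl//.
    - apply/measurable_EFinP.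
      exact: (measurableT_comp (@measurable_likelihood_Omega j) (measurable_pair1 w)).
    - by move=> t _; rewrite lee_fin likelihood_ge0.
  exact: (fubini_tonelli _ (mF j) (F0 j)).
rewrite !swap; apply: ge0_le_integral => //.
- by move=> t _; apply: integral_ge0 => w _; exact: (F0 k.+1 (w, t)).
- exact: (measurable_fun_fubini_tonelli_G (m1 := Pr) _ (mF k.+1) (F0 k.+1)).
- exact: (measurable_fun_fubini_tonelli_G (m1 := Pr) _ (mF k) (F0 k)).
move=> t _.
pose i0 := Ordinal m_gt0.
pose V (w : OH k) := (\1_G w * likelihood k t w)%R.
have V0 w : (0 <= V w)%R by rewrite mulr_ge0// likelihood_ge0.
have mV : measurable_fun setT V.
  apply: measurable_funM; first exact: measurable_indic.
  exact: (measurableT_comp (@measurable_likelihood k) (measurable_pair2 t)).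
(* The past likelihood and the indicator of [G] are absorbed into the first factor of the new batch,
   which exists because [0 < m]; the expectation is then a plain product over the batch. *)
pose hh (i : 'I_m) (x : OH k * T) :=
  (if i == i0 then V x.1 * h k t x.1 x.2 else h k t x.1 x.2)%R.
have mht : measurable_fun setT (fun x : OH k * T => h k t x.1 x.2).
  exact: (measurableT_comp (@mh k) (measurable_pair1 t)).
have hh0 i x : (0 <= hh i x)%R by rewrite /hh; case: ifP => // _; rewrite mulr_ge0.
have mhh i : measurable_fun setT (hh i).
  rewrite /hh; case: (i == i0) => //; apply: measurable_funM => //.
  exact: (measurableT_comp mV measurable_fst).
have := @conditional_product_le _ _ R Omega T Pr (H k) (@HM k) rho
  (fun x => p k x.1 x.2) (fun x => p0 k x.1 x.2) (@mp k) (p1 k) m (Z k) (mZ k)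
  (@Ziid k) hh hh0 mhh.
have -> : (fun w => \prod_(i < m) (hh i (w, Z k i w))%:E) =
    (fun w => (\1_G w * likelihood k.+1 t w)%:E).
  apply/funext => w; rewrite prodEFin /likelihood big_ord_recr/= mulrA -/(V w).
  rewrite (bigD1 i0)//= [in RHS](bigD1 i0)//= /hh eqxx mulrA.
  by congr ((_ * _)%:E); apply: eq_bigr => i /negbTE ->.
move=> /le_trans; apply.
apply: ge0_le_integral => //.
- by move=> w _; apply: prode_ge0 => i; apply: density_integral_ge0 => // x; rewrite lee_fin.
- apply: emeasurable_prod => i; apply: (@measurable_fun_sub_sigma _ _ (H k) (@HM k)) => //.
  by apply: measurable_density_integral => //; [move=> x; rewrite lee_fin|exact/measurable_EFinP].
- apply/measurable_EFinP; apply: (@measurable_fun_sub_sigma _ _ (H k) (@HM k)) => //.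
move=> w _.
apply: (@le_trans _ _ (\prod_(i < m) (if i == i0 then (V w)%:E else 1))); last first.
  rewrite (bigD1 i0)//= big1 ?mule1//.
  by move=> i /negbTE ->.
apply: lee_prod => i; rewrite density_integral_ge0/=; last 2 first.
- by move=> x; exact: p0.
- by move=> x; rewrite lee_fin.
rewrite /hh; case: (i == i0); rewrite /density_integral/=; last exact: h1.
under eq_integral do rewrite EFinM muleCA.
rewrite ge0_integralZl ?lee_fin//; last 2 first.
- apply: emeasurable_funM; apply/measurable_EFinP.
    exact: (measurableT_comp (@mp k) (measurable_pair1 (w : OH k))).
  exact: (measurableT_comp mht (measurable_pair1 (w : OH k))).
- by move=> z _; rewrite mule_ge0// lee_fin.
by rewrite -[leRHS]mule1 lee_wpmul2l// lee_fin.
Qed.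

End likelihood_process.

(** * Change of measure *)

Section change_of_measure.
Context d (T : measurableType d) (R : realType).

(* Both integrals may be infinite, or of the junk form [+oo - oo]. *)
Lemma ae_le_integral_ereal (mu : {measure set T -> \bar R}) (f g : T -> \bar R) :
  measurable_fun setT f -> measurable_fun setT g ->
  {ae mu, forall x, f x <= g x} -> \int[mu]_x f x <= \int[mu]_x g x.
Proof.
move=> mf mg fg; rewrite integralE [leRHS]integralE; apply: leeB.
- apply: ae_ge0_le_integral => //; [exact: measurable_funepos..|].
  apply: filterS fg => x fgx _.
  by rewrite !funeposE ge_max !le_max fgx lexx !orbT.
- apply: ae_ge0_le_integral => //; [exact: measurable_funeneg..|].
  apply: filterS fg => x fgx _.
  by rewrite !funenegE ge_max !le_max leeN2 fgx lexx !orbT.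
Qed.

Lemma measurable_lne : measurable_fun [set: \bar R] (@lne R).
Proof.
apply: (measurability _ (ErealGenOInfty.measurableE R)) => /= _ [_ [a ->]] <-.
rewrite setTI preimage_itvoy.
rewrite (_ : [set x | _] = `](expR a)%:E, +oo[%classic `|` [set +oo]).
  by apply: measurableU => //; exact: emeasurable_itv.
apply/seteqP; split => [[x| |]//=|[x| |]/=]; rewrite ?in_itv/= ?andbT.
- case: ifPn => // x0; rewrite -ltNge in x0.
  by rewrite !lte_fin => ax; left; rewrite -(lnK x0) ltr_expR.
- by right.
- case => //; rewrite !lte_fin => ax.
  have x0 : (0 < x)%R by exact: lt_trans (expR_gt0 a) ax.
  by rewrite leNgt x0/= lte_fin -ltr_expR lnK.
- by move=> _; exact: ltry.
- by case.
Qed.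

(** Powers are measurable, and on nonnegative reals the power [-1] is the inverse, including the
    value 0 at 0. *)
Lemma measurable_funV_ge0 (f : T -> R) : (forall x, (0 <= f x)%R) ->
  measurable_fun setT f -> measurable_fun setT (fun x => (f x)^-1)%R.
Proof.
move=> f0 mf; rewrite (_ : (fun _ => _) = (fun x => (f x) `^ (-1))%R).
  exact: (measurableT_comp (measurable_powR (-1)%R) mf).
by apply/funext => x; rewrite powR_inv1.
Qed.

Lemma bounded_integrable (Q : probability T R) (u : T -> R) b :
  measurable_fun setT u -> (forall t, (`|u t| <= b)%R) ->
  Q.-integrable setT (EFin \o u).
Proof.
move=> mu ub; apply: (@le_integrable _ _ _ Q _ measurableT _ (cst b%:E)) => //.
- exact/measurable_EFinP.
- by move=> t _; rewrite lee_fin (le_trans (ub t))// ler_norm.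
- exact: finite_measure_integrable_cst.
Qed.

(* Integrate [g - log r <= exp g / r - 1] under [Q], where [r = dQ/dP] and
   [g = F - ln a]. *)
Lemma donsker_varadhan (Q P : probability T R) (F : T -> R) (a c : R) :
  measurable_fun setT F -> (forall t, (`|F t| <= c)%R) -> (0 < a)%R ->
  \int[P]_t (expR (F t))%:E <= a%:E ->
  \int[Q]_t (F t)%:E <= KL Q P + (ln a)%:E.
Proof.
move=> mF Fc a0 PF; rewrite /KL; case: asboolP => QP; last by rewrite addye ?leey.
(* A finite, nonnegative version of the density allows real arithmetic; it agrees [P]-almost
   everywhere, hence [Q]-almost everywhere, with the derivative in [KL]. *)
pose r : T -> \bar R := Radon_Nikodym_SigmaFinite.f Q P.
have r0 t : 0 <= r t by exact: Radon_Nikodym_SigmaFinite.f_ge0.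
have rfin t : r t \is a fin_num by exact: Radon_Nikodym_SigmaFinite.f_fin_num.
have mr : measurable_fun setT r.
  exact: (measurable_int _ (Radon_Nikodym_SigmaFinite.f_integrable QP)).
have rint A : measurable A -> Q A = \int[P]_(t in A) r t.
  exact: Radon_Nikodym_SigmaFinite.f_integral.
pose s t := fine (r t).
have rE t : r t = (s t)%:E by rewrite fineK.
have s0 t : (0 <= s t)%R by rewrite fine_ge0.
have ms : measurable_fun setT s by exact: measurableT_comp.
have -> : \int[Q]_t lne (Radon_Nikodym (charge_of_finite_measure Q) P t) =
    \int[Q]_t lne (r t).
  have mRN := measurable_int _ (Radon_Nikodym_integrable (nu := charge_of_finite_measure Q) QP).
  apply: ae_eq_integral => //.
  - exact: (measurableT_comp measurable_lne mRN).
  - exact: (measurableT_comp measurable_lne mr).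
  have := null_dominates_ae_eq measurableT QP
    (ae_eq_Radon_Nikodym_SigmaFinite QP measurableT).
  by apply: filterS => t /(_ I) <-.
have sgt0 : {ae Q, forall t, (0 < s t)%R}.
  have mN : measurable [set t | s t = 0%R].
    by rewrite -[X in measurable X]setTI; exact: (ms measurableT [set 0%R]).
  exists [set t | s t = 0%R]; split => //.
  - rewrite rint//.
    by apply: integral0_eq => t /= st; rewrite rE st.
  - by move=> t /= /negP; rewrite -leNgt => st; apply/eqP; rewrite eq_le st s0.
pose g t := (F t - ln a)%R.
have mg : measurable_fun setT g by exact: measurable_funB.
pose psi t := (expR (g t) / s t)%R.
have psi0 t : (0 <= psi t)%R by rewrite divr_ge0// expR_ge0.
have mpsi : measurable_fun setT psi.
  apply: measurable_funM; first exact: measurableT_comp.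
  exact: measurable_funV_ge0.
have psi1 : \int[Q]_t (psi t)%:E <= 1.
  have psiE0 t : 0 <= (psi t)%:E by rewrite lee_fin.
  have mpsiE : measurable_fun setT (EFin \o psi) by exact/measurable_EFinP.
  rewrite -(Radon_Nikodym_SigmaFinite.change_of_variables QP psiE0 measurableT mpsiE).
  apply: (@le_trans _ _ (\int[P]_t (a^-1%:E * (expR (F t))%:E))).
    apply: ge0_le_integral => //.
    + by move=> t _; rewrite mule_ge0// lee_fin.
    + by apply: emeasurable_funM => //; exact/measurable_EFinP.
    + apply: emeasurable_funM => //; apply/measurable_EFinP.
      exact: measurableT_comp.
    (* Where the density vanishes the left side is 0, so only an inequality holds there; elsewhere
       the density cancels. *)
    + move=> t _; rewrite -/(r t) rE -!EFinM lee_fin /psi /g expRB lnK ?posrE//.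
      have [->|sn0] := eqVneq (s t) 0%R.
        by rewrite mulr0 mulr_ge0// ?expR_ge0// invr_ge0 ltW.
      by rewrite divfK// mulrC.
  have meF : measurable_fun setT (fun t => (expR (F t))%:E).
    by apply/measurable_EFinP; exact: measurableT_comp.
  have eF0 t : setT t -> 0 <= (expR (F t))%:E by rewrite lee_fin expR_ge0.
  have ai0 : 0 <= (a^-1)%:E by rewrite lee_fin invr_ge0 ltW.
  rewrite (ge0_integralZl _ measurableT meF eF0 ai0).
  apply: (@le_trans _ _ (a^-1%:E * a%:E)).
    by apply: lee_wpmul2l => //; rewrite lee_fin invr_ge0 ltW.
  by rewrite -EFinM mulVf ?gt_eqF.
have iF : Q.-integrable setT (EFin \o F) by exact: bounded_integrable Fc.
have ig : Q.-integrable setT (EFin \o g).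
  apply: (@bounded_integrable _ _ (c + `|ln a|)%R) => // t.
  by rewrite (le_trans (ler_normB _ _))// lerD.
have ipsi : Q.-integrable setT (EFin \o psi).
  apply/integrableP; split; first exact/measurable_EFinP.
  under eq_integral do rewrite gee0_abs ?lee_fin//.
  exact: le_lt_trans psi1 (ltry _).
have cstQ b : \int[Q]_t (b%:E : \bar R) = b%:E.
  by rewrite integral_cst//= probability_setT mule1.
have icst b : Q.-integrable setT (fun=> b%:E : \bar R).
  exact: finite_measure_integrable_cst.
have FgE : \int[Q]_t (F t)%:E = \int[Q]_t (g t)%:E + (ln a)%:E.
  rewrite -[in RHS](cstQ (ln a)) -integralD//.
  by apply: eq_integral => t _; rewrite -EFinD subrK.
rewrite FgE leeD2r//.
have i1psi : Q.-integrable setT (fun t => 1 - (psi t)%:E).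
  exact: (integrableB measurableT (icst 1%R) ipsi).
apply: (@le_trans _ _ (\int[Q]_t ((g t)%:E + (1 - (psi t)%:E)))).
  rewrite integralD// integralB//= cstQ -[leLHS]adde0 leeD2l//.
  by rewrite sube_ge0 ?orbT.
apply: ae_le_integral_ereal.
- by apply: emeasurable_funD; [exact: measurable_int ig|exact: measurable_int i1psi].
- exact: (measurableT_comp measurable_lne mr).
apply: filterS sgt0 => t st.
rewrite rE lne_EFin// -EFinB -EFinD lee_fin.
(* This is [1 + u <= exp u] at [u = g - log s], whose exponential is [psi]. *)
have := expR_ge1Dx (g t - ln (s t))%R.
by rewrite expRB lnK ?posrE// -/(psi t); lra.
Qed.

End change_of_measure.

(** * Logarithmic smoothing with densities *)

Section logarithmic_smoothing.
Context d d' dP (R : realType) (Omega : measurableType d)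
  (T : measurableType d') (Theta : measurableType dP).
Variables (Pr : probability Omega R) (P : probability Theta R).
Variable H : nat -> set (set Omega).
Hypotheses (HM : forall k, H k `<=` measurable)
  (Hmono : forall j k, (j <= k)%N -> H j `<=` H k).
Local Notation OH k := (g_sigma_algebraType (H k)).
Variables (rho : {finite_measure set T -> \bar R}).
Variable p : nat -> Omega -> T -> R.
Hypotheses (p0 : forall k w z, (0 <= p k w z)%R)
  (mp : forall k, measurable_fun setT (fun x : OH k * T => p k x.1 x.2)).
Hypothesis p1 : forall k w, \int[rho]_z (p k w z)%:E = 1.
Variables (m : nat) (Z : nat -> 'I_m -> Omega -> T).
Hypothesis m_gt0 : (0 < m)%N.
Hypothesis mZ : forall k i, measurable_fun setT (Z k i).
Hypothesis Zadapted : forall j k i, (j < k)%N ->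
  measurable_fun setT (Z j i : OH k -> T).
Hypothesis Ziid : forall k (G : set Omega) (B : 'I_m -> set T),
  <<s H k >> G -> (forall i, measurable (B i)) ->
  Pr (G `&` [set w | forall i, B i (Z k i w)]) =
  \int[Pr]_(w in G) \prod_(i < m) \int[rho]_z ((p k w z)%:E * (\1_(B i) z)%:E).
Variables (lambda : R) (ell : T -> R) (a : Theta -> T -> bool).
Hypotheses (lambda0 : (0 < lambda)%R) (ell01 : forall z, (0 <= ell z <= 1)%R)
  (mell : measurable_fun setT ell)
  (ma : measurable_fun setT (fun x : Theta * T => (a x.1 x.2)%:R%R : R)).

Let v k w z : R := (lambda * ell z / p k w z)%R.
Let ft t z : R := (a t z)%:R%R.

(* With [q] the density of a policy, this is minus its risk. *)
Definition expected_loss (q : T -> R) : R := fine (\int[rho]_z (q z * ell z)%:E).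

(** Where [p] vanishes, the quotient is 0 and so is the weight. *)
Definition log_weight k w z : R := ln (1 + lambda * ell z / p k w z).

Let r t := expected_loss (ft t).

Let ell0 z : (0 <= ell z)%R. Proof. by have /andP[] := ell01 z. Qed.
Let ell1 z : (ell z <= 1)%R. Proof. by have /andP[] := ell01 z. Qed.

Let v0 k w z : (0 <= v k w z)%R.
Proof. by rewrite divr_ge0// mulr_ge0// ltW. Qed.

Let mv k : measurable_fun setT (fun x : OH k * T => v k x.1 x.2).
Proof.
apply: measurable_funM.
  by apply: measurable_funM => //; exact: (measurableT_comp mell measurable_snd).
by apply: measurable_funV_ge0 => // x; exact: p0.
Qed.

Let mft : measurable_fun setT (fun x : Theta * T => ft x.1 x.2) := ma.

Lemma expected_lossE (q : T -> R) :
  (forall z, (0 <= q z <= 1)%R) -> measurable_fun setT q ->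
  \int[rho]_z (q z * ell z)%:E = (expected_loss q)%:E.
Proof.
move=> q01 mq.
have q0 z : (0 <= q z)%R by have /andP[] := q01 z.
have q1 z : (q z <= 1)%R by have /andP[] := q01 z.
rewrite /expected_loss fineK// ge0_fin_numE; last first.
  by apply: integral_ge0 => z _; rewrite lee_fin mulr_ge0.
apply: (@le_lt_trans _ _ (\int[rho]_z (1%:E : \bar R))); last first.
  by rewrite integral_cst// mul1e -ge0_fin_numE// fin_num_measure.
apply: ge0_le_integral => //.
- by move=> z _; rewrite lee_fin mulr_ge0.
- by apply/measurable_EFinP; exact: measurable_funM.
- by move=> z _; rewrite lee_fin mulr_ile1.
Qed.

Let ft01 t z : (0 <= ft t z <= 1)%R.
Proof. by rewrite /ft; case: (a t z); rewrite /= ?lexx ler01. Qed.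

Let ft0 t z : (0 <= ft t z)%R. Proof. by have /andP[] := ft01 t z. Qed.

Let ft1 t z : (ft t z <= 1)%R. Proof. by have /andP[] := ft01 t z. Qed.

Let mftz t : measurable_fun setT (ft t).
Proof. exact: (measurableT_comp mft (measurable_pair1 t)). Qed.

(** The total mass of [rho] serves as the bound. The change of measure is stated for bounded
    functions, and [r] is part of the exponent. *)
Let r_bound : exists c, forall t, (0 <= r t <= c)%R.
Proof.
exists (fine (rho setT)) => t; rewrite -!lee_fin -expected_lossE//.
apply/andP; split.
  by apply: integral_ge0 => z _; rewrite lee_fin mulr_ge0.
rewrite fineK ?fin_num_measure// -[leRHS]mul1e -integral_cst//.
apply: ge0_le_integral => //.
- by move=> z _; rewrite lee_fin mulr_ge0.
- by apply/measurable_EFinP; exact: measurable_funM.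
- by move=> z _; rewrite lee_fin mulr_ile1.
Qed.

Let mr : measurable_fun setT r.
Proof.
apply: measurableT_comp => //.
apply: (measurable_fun_fubini_tonelli_F (m2 := rho)
  (fun x : Theta * T => (ft x.1 x.2 * ell x.2)%:E)).
  apply/measurable_EFinP; apply: measurable_funM => //.
  exact: (measurableT_comp mell measurable_snd).
by move=> x; rewrite lee_fin mulr_ge0.
Qed.

Let mpz k w : measurable_fun setT (p k w).
Proof. exact: (measurableT_comp (@mp k) (measurable_pair1 (w : OH k))). Qed.

Let mvz k w : measurable_fun setT (v k w).
Proof. exact: (measurableT_comp (@mv k) (measurable_pair1 (w : OH k))). Qed.

(** Since [ft] takes only the values 0 and 1, [1 + ft * v] equals [exp (ft * log (1 + v))]; the
    affine form can be integrated against [p] directly. *)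
Let hup k t w z : R := (expR (- (lambda * r t)) * (1 + ft t z * v k w z))%R.

Let hup0 k t w z : (0 <= hup k t w z)%R.
Proof. by rewrite mulr_ge0 ?expR_ge0// addr_ge0// mulr_ge0. Qed.

Let mhup k : measurable_fun setT
  (fun x : Theta * (OH k * T) => hup k x.1 x.2.1 x.2.2).
Proof.
apply: measurable_funM.
  apply: measurableT_comp => //; apply: measurableT_comp => //.
  by apply: measurable_funM => //; exact: (measurableT_comp mr measurable_fst).
apply: measurable_funD => //; apply: measurable_funM.
  pose phi (x : Theta * (OH k * T)) : Theta * T := (x.1, x.2.2).
  have mphi : measurable_fun setT phi.
    by apply: measurable_fun_pair => //; exact: measurableT_comp.
  exact: (measurableT_comp mft mphi).
exact: (measurableT_comp (@mv k) measurable_snd).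
Qed.

(** Multiplied by [p], the term [ft * v] becomes [lambda * ft * ell] where [p] is positive and 0
    elsewhere, so the affine factor integrates to at most [1 + lambda * r], hence to at most
    [exp (lambda * r)]. *)
Let hup1 k t w : \int[rho]_z ((p k w z)%:E * (hup k t w z)%:E) <= 1.
Proof.
have le1 z : ((p k w z)%:E * (hup k t w z)%:E <=
    (expR (- (lambda * r t)))%:E * ((p k w z)%:E + lambda%:E * (ft t z * ell z)%:E)).
  rewrite -!(EFinM, EFinD) lee_fin /hup mulrCA ler_wpM2l ?expR_ge0//.
  rewrite mulrDr mulr1 lerD2l /v; have [->|pn0] := eqVneq (p k w z) 0%R.
    by rewrite mul0r !mulr_ge0// ltW.
  by rewrite le_eqVlt; apply/orP; left; apply/eqP; field.
have e0 : 0 <= (expR (- (lambda * r t)))%:E by rewrite lee_fin expR_ge0.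
have mpE : measurable_fun setT (fun z => (p k w z)%:E) by exact/measurable_EFinP.
have mfe : measurable_fun setT (fun z => (ft t z * ell z)%:E).
  by apply/measurable_EFinP; exact: measurable_funM.
have mlfe : measurable_fun setT (fun z => lambda%:E * (ft t z * ell z)%:E).
  by apply: emeasurable_funM.
have msum : measurable_fun setT
    (fun z => (p k w z)%:E + lambda%:E * (ft t z * ell z)%:E).
  exact: emeasurable_funD.
have fe0 z : 0 <= (ft t z * ell z)%:E by rewrite lee_fin mulr_ge0.
have lfe0 z : 0 <= lambda%:E * (ft t z * ell z)%:E.
  by rewrite mule_ge0// lee_fin ltW.
have sum0 z : 0 <= (p k w z)%:E + lambda%:E * (ft t z * ell z)%:E.
  by rewrite adde_ge0// lee_fin.
apply: (@le_trans _ _ (\int[rho]_z ((expR (- (lambda * r t)))%:E *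
    ((p k w z)%:E + lambda%:E * (ft t z * ell z)%:E)))).
  apply: ge0_le_integral => //.
  - by move=> z _; rewrite mule_ge0// lee_fin.
  - apply: emeasurable_funM => //; apply/measurable_EFinP.
    apply: measurable_funM => //; apply: measurable_funD => //.
    exact: measurable_funM.
  - exact: emeasurable_funM.
have lE0 : 0 <= lambda%:E by rewrite lee_fin ltW.
rewrite (ge0_integralZl rho measurableT msum (fun z _ => sum0 z) e0).
have pE0 z : 0 <= (p k w z)%:E by rewrite lee_fin.
rewrite (ge0_integralD rho measurableT (fun z _ => pE0 z) mpE (fun z _ => lfe0 z) mlfe).
rewrite (ge0_integralZl rho measurableT mfe (fun z _ => fe0 z) lE0).
rewrite p1 expected_lossE// -/(r t) -!(EFinM, EFinD) lee_fin.
rewrite -[leRHS]expR0 -[X in (_ <= expR X)%R](addNr (lambda * r t)%R) expRD.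
by rewrite ler_wpM2l ?expR_ge0// expR_ge1Dx.
Qed.

(** * Simultaneous upper and lower confidence bounds *)

Section fixed_policy.
Variable q : T -> R.
Hypotheses (q01 : forall z, (0 <= q z <= 1)%R) (mq : measurable_fun setT q).

Let g k w z : R := expR (- (q z * log_weight k w z)).

Definition normalizer k w : R := fine (\int[rho]_z ((p k w z)%:E * (g k w z)%:E)).

Let mg k : measurable_fun setT (fun x : OH k * T => g k x.1 x.2).
Proof.
apply: measurableT_comp => //; apply: measurableT_comp => //.
apply: measurable_funM; first exact: (measurableT_comp mq measurable_snd).
by apply: measurableT_comp => //; apply: measurable_funD => //; exact: mv.
Qed.

Let mgz k w : measurable_fun setT (g k w).
Proof. exact: (measurableT_comp (@mg k) (measurable_pair1 (w : OH k))). Qed.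

Lemma log_weight_ge0 k w z : (0 <= log_weight k w z)%R.
Proof. by rewrite ln_ge0// lerDl; exact: v0. Qed.

Let q0 z : (0 <= q z)%R. Proof. by have /andP[] := q01 z. Qed.

Let g0 k w z : (0 <= g k w z)%R. Proof. exact: expR_ge0. Qed.

Let g1 k w z : (g k w z <= 1)%R.
Proof. by rewrite -expR0 ler_expR oppr_le0 mulr_ge0 ?log_weight_ge0. Qed.

Lemma normalizerE k w :
  \int[rho]_z ((p k w z)%:E * (g k w z)%:E) = (normalizer k w)%:E.
Proof.
rewrite /normalizer fineK// ge0_fin_numE; last first.
  by apply: integral_ge0 => z _; rewrite mule_ge0// lee_fin.
apply: (@le_lt_trans _ _ (\int[rho]_z (p k w z)%:E)); last by rewrite p1 ltry.
apply: ge0_le_integral => //.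
- by move=> z _; rewrite mule_ge0// lee_fin.
- by apply: emeasurable_funM; exact/measurable_EFinP.
- exact/measurable_EFinP.
- by move=> z _; rewrite -EFinM lee_fin -[leRHS]mulr1 ler_wpM2l.
Qed.

(* The factor [exp (1 - N)] replaces the exact normalization [1 / N]: it suffices
   because [N exp (1 - N) <= 1], and it does not require [N > 0]. *)
Let hlo k (t : Theta) w z : R := (g k w z * expR (1 - normalizer k w))%R.

Let hlo0 k t w z : (0 <= hlo k t w z)%R.
Proof. by rewrite mulr_ge0// expR_ge0. Qed.

Let mhlo k : measurable_fun setT
  (fun x : Theta * (OH k * T) => hlo k x.1 x.2.1 x.2.2).
Proof.
apply: measurable_funM; first exact: (measurableT_comp (@mg k) measurable_snd).
have mN : measurable_fun setT (normalizer k : OH k -> R).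
  apply: measurableT_comp => //.
  apply: (measurable_fun_fubini_tonelli_F (m2 := rho)
    (fun x : OH k * T => (p k x.1 x.2)%:E * (g k x.1 x.2)%:E)).
    by apply: emeasurable_funM; exact/measurable_EFinP.
  by move=> x; rewrite mule_ge0// lee_fin.
have mN' : measurable_fun setT
    (fun x : Theta * (OH k * T) => normalizer k x.2.1).
  exact: (measurableT_comp mN (measurableT_comp measurable_fst measurable_snd)).
have m1N : measurable_fun setT
    (fun x : Theta * (OH k * T) => 1 - normalizer k x.2.1)%R.
  by apply: measurable_funB.
exact: (measurableT_comp (@measurable_expR R) m1N).
Qed.

Let hlo1 k t w : \int[rho]_z ((p k w z)%:E * (hlo k t w z)%:E) <= 1.
Proof.
under eq_integral do rewrite /hlo EFinM muleA muleC.
have mpg : measurable_fun setT (fun z => (p k w z)%:E * (g k w z)%:E).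
  by apply: emeasurable_funM; exact/measurable_EFinP.
have pg0 z : 0 <= (p k w z)%:E * (g k w z)%:E by rewrite mule_ge0// lee_fin.
have e0 : 0 <= (expR (1 - normalizer k w))%:E by rewrite lee_fin expR_ge0.
rewrite (ge0_integralZl rho measurableT mpg (fun z _ => pg0 z) e0).
rewrite normalizerE -EFinM lee_fin.
have h := expR_ge1Dx (normalizer k w - 1)%R.
rewrite addrC subrK in h.
apply: le_trans (ler_wpM2l (expR_ge0 _) h) _.
by rewrite -expRD addrA subrK subrr expR0.
Qed.

Lemma confidence_event (delta : R) : (0 < delta)%R ->
  exists E : set Omega, [/\ measurable E, (1 - delta)%:E <= Pr E &
    forall w, E w -> forall k,
      mixture_likelihood P Z hup k w <= (2 / delta)%:E /\
      mixture_likelihood P Z hlo k w <= (2 / delta)%:E].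
Proof.
move=> d0.
pose A := mixture_likelihood P Z hup; pose B := mixture_likelihood P Z hlo.
have p1' k w : \int[rho]_z (p k w z)%:E <= 1 by rewrite p1.
have mA k : measurable_fun setT (A k : OH k -> \bar R).
  exact: measurable_mixture_likelihood.
have mB k : measurable_fun setT (B k : OH k -> \bar R).
  exact: measurable_mixture_likelihood.
have A0 k w : 0 <= A k w by exact: mixture_likelihood_ge0.
have B0 k w : 0 <= B k w by exact: mixture_likelihood_ge0.
have mAO k : measurable_fun [set: Omega] (A k).
  exact: (@measurable_fun_sub_sigma _ _ (H k) (@HM k)).
have mBO k : measurable_fun [set: Omega] (B k).
  exact: (@measurable_fun_sub_sigma _ _ (H k) (@HM k)).
pose U k w := A k w + B k w.
have U0 k w : 0 <= U k w by exact: adde_ge0.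
have mU k : measurable_fun setT (U k : OH k -> \bar R) by exact: emeasurable_funD.
have Ustep k G : <<s H k >> G ->
    \int[Pr]_(w in G) U k.+1 w <= \int[Pr]_(w in G) U k w.
  move=> sG; have mG := sigma_algebra_sub_measurable (@HM k) sG.
  have UD j : \int[Pr]_(w in G) U j w =
      \int[Pr]_(w in G) A j w + \int[Pr]_(w in G) B j w.
    by apply: ge0_integralD => //; exact: measurable_funTS.
  have stepA : \int[Pr]_(w in G) A k.+1 w <= \int[Pr]_(w in G) A k w.
    exact: (mixture_likelihood_step P (@HM) (@Hmono) p0 (@mp) p1' m_gt0
      mZ (@Zadapted) (@Ziid) hup0 (@mhup) hup1 sG).
  have stepB : \int[Pr]_(w in G) B k.+1 w <= \int[Pr]_(w in G) B k w.
    exact: (mixture_likelihood_step P (@HM) (@Hmono) p0 (@mp) p1' m_gt0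
      mZ (@Zadapted) (@Ziid) hlo0 (@mhlo) hlo1 sG).
  rewrite (UD k.+1) (UD k); exact: leeD stepA stepB.
have c0 : (0 < 2 / delta)%R by rewrite divr_gt0.
have := ville_inequality HM (fun k => Hmono (leqnSn k)) U0 mU Ustep c0.
set V := \bigcup_k _.
have mV : measurable V.
  apply: bigcup_measurable => k _.
  have := @emeasurable_fun_c_infty _ _ _ _ (U k) measurableT
    (emeasurable_funD (mAO k) (mBO k)) (2 / delta)%:E.
  by rewrite setTI.
have -> : \int[Pr]_w U 0%N w = 2%:E.
  transitivity (\int[Pr]_w (2%:E : \bar R)).
    by apply: eq_integral => w _; rewrite /U /A /B !mixture_likelihood0 -EFinD.
  by rewrite integral_cst//= probability_setT mule1.
move=> ineq; exists (~` V); split; first exact: measurableC.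
  rewrite probability_setC// EFinB leeB//.
  (* Both processes start at 1, so their sum reaches [2 / delta] with probability at most
     [2 / (2 / delta) = delta]. *)
  have : (delta / 2)%:E * ((2 / delta)%:E * Pr V) <= (delta / 2)%:E * 2%:E.
    by rewrite lee_wpmul2l// lee_fin divr_ge0// ltW.
  rewrite muleA -!EFinM divfK// [(_ * (2 / delta))%R](_ : _ = 1%R) ?mul1e//.
  by field; rewrite gt_eqF.
move=> w nVw k; have : ~ (2 / delta)%:E <= U k w by move=> h; apply: nVw; exists k.
move=> /negP; rewrite -ltNge => /ltW Uc.
by split; apply: le_trans Uc; rewrite ?leeDl ?leeDr.
Qed.


(** The factors of the lower process are constant in the parameter, so averaging under the prior
    changes nothing; the dummy parameter lets both processes share one supermartingale lemma. *)
Let mixture_hlo k w : mixture_likelihood P Z hlo k w =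
  (expR (\sum_(j < k) \sum_(i < m) (- (q (Z j i w) * log_weight j w (Z j i w)) +
    (1 - normalizer j w))))%:E.
Proof.
set e := expR _.
transitivity (\int[P]_t (e%:E : \bar R)); last first.
  by rewrite integral_cst//= probability_setT mule1.
apply: eq_integral => t _; congr (_%:E); rewrite /e.
rewrite expR_sum; apply: eq_bigr => j _; rewrite expR_sum; apply: eq_bigr => i _.
by rewrite expRD.
Qed.

Let likelihood_hup k t w : likelihood Z hup k t w =
  expR (\sum_(j < k) \sum_(i < m)
    (ft t (Z j i w) * log_weight j w (Z j i w) - lambda * r t)).
Proof.
rewrite expR_sum; apply: eq_bigr => j _; rewrite expR_sum; apply: eq_bigr => i _.
rewrite expRB mulrC -expRN /hup; congr (_ * _)%R.
rewrite /ft; case: (a t _); last by rewrite !mul0r addr0 expR0.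
by rewrite !mul1r lnK// posrE ltr_pwDl//; exact: v0.
Qed.

Lemma integral_mean_action (Q : probability Theta R) z :
  \int[Q]_t (ft t z)%:E = ((\int[Q]_t ft t z)%R)%:E.
Proof.
have mftz' : measurable_fun setT (ft ^~ z).
  exact: (measurableT_comp mft (measurable_pair2 z)).
rewrite /Rintegral fineK// ge0_fin_numE; last first.
  by apply: integral_ge0 => t _; rewrite lee_fin.
apply: (@le_lt_trans _ _ (\int[Q]_t (1%:E : \bar R))); last first.
  by rewrite integral_cst//= probability_setT mule1 ltry.
apply: ge0_le_integral => //.
- by move=> t _; rewrite lee_fin.
- exact/measurable_EFinP.
- by move=> t _; rewrite lee_fin.
Qed.

Lemma mean_action01 (Q : probability Theta R) z :
  (0 <= (\int[Q]_t ft t z)%R <= 1)%R.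
Proof.
have mftz' : measurable_fun setT (ft ^~ z).
  exact: (measurableT_comp mft (measurable_pair2 z)).
rewrite -!lee_fin -integral_mean_action; apply/andP; split.
  by apply: integral_ge0 => t _; rewrite lee_fin.
apply: (@le_trans _ _ (\int[Q]_t (1%:E : \bar R))); last first.
  by rewrite integral_cst//= probability_setT mule1.
apply: ge0_le_integral => //.
- by move=> t _; rewrite lee_fin.
- exact/measurable_EFinP.
- by move=> t _; rewrite lee_fin.
Qed.

Lemma measurable_mean_action (Q : probability Theta R) :
  measurable_fun setT (fun z => (\int[Q]_t ft t z)%R).
Proof.
apply: measurableT_comp => //.
apply: (measurable_fun_fubini_tonelli_G (m1 := Q)
  (fun x : Theta * T => (ft x.1 x.2)%:E)); first exact/measurable_EFinP.
by move=> x; rewrite lee_fin.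
Qed.

(** By Tonelli, the risk is linear in the posterior. *)
Lemma integral_expected_loss (Q : probability Theta R) :
  \int[Q]_t (r t)%:E = (expected_loss (fun z => (\int[Q]_t ft t z)%R))%:E.
Proof.
rewrite -expected_lossE; [|exact: mean_action01|exact: measurable_mean_action].
under eq_integral do rewrite -expected_lossE//.
have mF : measurable_fun setT (fun x : Theta * T => (ft x.1 x.2 * ell x.2)%:E).
  apply/measurable_EFinP; apply: measurable_funM => //.
  exact: (measurableT_comp mell measurable_snd).
have F0 (x : Theta * T) : 0 <= (ft x.1 x.2 * ell x.2)%:E.
  by rewrite lee_fin mulr_ge0.
rewrite (fubini_tonelli (m1 := Q) (m2 := rho) _ mF F0).
apply: eq_integral => z _ /=; rewrite EFinM -integral_mean_action muleC.
have mftz' : measurable_fun setT (fun t => (ft t z)%:E).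
  by apply/measurable_EFinP; exact: (measurableT_comp mft (measurable_pair2 z)).
have lE0 : 0 <= (ell z)%:E by rewrite lee_fin.
have fE0 t : 0 <= (ft t z)%:E by rewrite lee_fin.
rewrite -(ge0_integralZl Q measurableT mftz' (fun t _ => fE0 t) lE0).
by apply: eq_integral => t _; rewrite EFinM muleC.
Qed.

(** At a fixed [w], the exponent of the likelihood is a bounded function of the parameter, and the
    change of measure applies to it for every [Q]. Integrating under [Q] turns indicators into the
    mixture policy and [r] into its expected loss. *)
Let upper_bound k w (delta : R) (Q : probability Theta R) : (0 < delta)%R ->
  mixture_likelihood P Z hup k w <= (2 / delta)%:E ->
  (\sum_(j < k) \sum_(i < m) ((\int[Q]_t ft t (Z j i w))%R * log_weight j w (Z j i w)
     - lambda * expected_loss (fun z => (\int[Q]_t ft t z)%R)))%:E <=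
  KL Q P + (ln (2 / delta))%:E.
Proof.
move=> d0 hk.
pose F t := (\sum_(j < k) \sum_(i < m)
    (ft t (Z j i w) * log_weight j w (Z j i w) - lambda * r t))%R.
have mftz' z : measurable_fun setT (ft ^~ z).
  exact: (measurableT_comp mft (measurable_pair2 z)).
pose G (x : 'I_k * 'I_m) t :=
  (ft t (Z x.1 x.2 w) * log_weight x.1 w (Z x.1 x.2 w) - lambda * r t)%R.
have mG x : measurable_fun setT (G x).
  by apply: measurable_funB; apply: measurable_funM.
have FE t : F t = (\sum_x G x t)%R by rewrite /F pair_bigA.
have mF : measurable_fun setT F.
  rewrite (_ : F = fun t => (\sum_x G x t)%R); last exact/funext.
  exact: measurable_sum.
have [C rC] := r_bound.
pose c (x : 'I_k * 'I_m) := (log_weight x.1 w (Z x.1 x.2 w) + lambda * C)%R.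
have Gc x t : (`|G x t| <= c x)%R.
  apply: le_trans (ler_normB _ _) _; apply: lerD.
    rewrite normrM ger0_norm// ger0_norm ?log_weight_ge0//.
    by rewrite ler_piMl// log_weight_ge0.
  have /andP[rt0 rtC] := rC t.
  by rewrite normrM gtr0_norm// ger0_norm// ler_wpM2l// ltW.
have Fc t : (`|F t| <= \sum_x c x)%R.
  by rewrite FE; apply: le_trans (ler_norm_sum _ _ _) _; exact: ler_sum.
have c0 : (0 < 2 / delta)%R by rewrite divr_gt0.
have := @donsker_varadhan _ _ R Q P F (2 / delta)%R _ mF Fc c0.
have -> : \int[P]_t (expR (F t))%:E = mixture_likelihood P Z hup k w.
  by apply: eq_integral => t _; rewrite likelihood_hup.
move=> /(_ hk); apply: le_trans.
have ir : Q.-integrable setT (EFin \o r).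
  apply: (@bounded_integrable _ _ _ _ _ C) => // t.
  by have /andP[rt0 rtC] := rC t; rewrite ger0_norm.
have ift z : Q.-integrable setT (EFin \o (ft ^~ z)).
  by apply: (@bounded_integrable _ _ _ _ _ 1%R) => // t; rewrite ger0_norm.
under eq_integral do rewrite FE -sumEFin.
rewrite integral_sum//; last by move=> x; exact: (@bounded_integrable _ _ _ _ _ (c x)).
rewrite pair_bigA/= -sumEFin; apply: lee_sum => x _.
under eq_integral do rewrite /G EFinB EFinM muleC EFinM.
rewrite integralB//; last 2 first.
- exact: (integrableZl measurableT _ (ift _)).
- exact: (integrableZl measurableT _ ir).
rewrite (integralZl measurableT (ift _)) (integralZl measurableT ir).
by rewrite integral_expected_loss integral_mean_action -!EFinM -EFinB mulrC.
Qed.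

Let lower_bound k w (delta : R) : (0 < delta)%R ->
  mixture_likelihood P Z hlo k w <= (2 / delta)%:E ->
  (\sum_(j < k) \sum_(i < m) (- (q (Z j i w) * log_weight j w (Z j i w)) +
    (1 - normalizer j w)) <= ln (2 / delta))%R.
Proof.
move=> d0; rewrite mixture_hlo lee_fin => h.
by rewrite -ler_expR lnK// posrE divr_gt0.
Qed.

(** The order of quantifiers matters: [E] is chosen before [w] and [Q], so [Q] may depend on the
    data, whereas [q] is fixed in advance. *)
Theorem log_smoothing_event (delta : R) : (0 < delta)%R ->
  exists E : set Omega, [/\ measurable E, (1 - delta)%:E <= Pr E &
    forall w, E w -> forall k,
     (forall Q : probability Theta R,
       (\sum_(j < k) \sum_(i < m)
        ((\int[Q]_t (a t (Z j i w))%:R)%R * log_weight j w (Z j i w)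
         - lambda * expected_loss (fun z => (\int[Q]_t (a t z)%:R)%R)))%:E <=
       KL Q P + (ln (2 / delta))%:E) /\
     (\sum_(j < k) \sum_(i < m) (- (q (Z j i w) * log_weight j w (Z j i w)) +
       (1 - normalizer j w)) <= ln (2 / delta))%R].
Proof.
move=> d0; have [E [mE PE hE]] := confidence_event d0.
exists E; split => // w Ew k; have [hA hB] := hE w Ew k.
by split; [move=> Q; exact: upper_bound|exact: lower_bound].
Qed.

(** [(1 + x)^(- s)] is convex in [s], so on the unit interval it lies below its chord
    [1 - s + s / (1 + x)]; then [1 / (1 + x) <= 1 - x + x ^ 2]. *)
Lemma expR_convex_bound (s x : R) : (0 <= s <= 1)%R -> (0 <= x)%R ->
  (expR (- (s * ln (1 + x))) <= 1 - s * x + s * x ^+ 2)%R.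
Proof.
move=> /andP[s0 s1] x0; set y := ln _.
have eyE : (expR (- y) = (1 + x)^-1)%R by rewrite expRN lnK// posrE ltr_pwDl.
(* The chord bound comes from [1 + u <= exp u] at [s y] and at [s y - y]: with weights [1 - s] and
   [s], the left sides add up to 1. *)
have h0 := expR_ge1Dx (s * y)%R.
have h1 := expR_ge1Dx (- y + s * y)%R.
have e0 := expR_gt0 (- (s * y))%R.
have h : (expR (- (s * y)) <= 1 - s + s * (1 + x)^-1)%R.
  rewrite -eyE.
  have E0 : (expR (- (s * y)) * expR (s * y) = 1)%R by rewrite -expRD addNr expR0.
  have E1 : (expR (- (s * y)) * expR (- y + s * y) = expR (- y))%R.
    by rewrite -expRD addrCA addNr addr0.
  have := ler_wpM2l (ltW e0) h0; have := ler_wpM2l (ltW e0) h1.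
  rewrite E0 E1 => H1 H0.
  have s1' : (0 <= 1 - s)%R by rewrite subr_ge0.
  apply: le_trans (_ : _ <= (1 - s) * 1 + s * expR (- y))%R _; last by rewrite mulr1.
  apply: le_trans (lerD (ler_wpM2l s1' H0) (ler_wpM2l s0 H1)).
  by rewrite le_eqVlt; apply/orP; left; apply/eqP; ring.
apply: (le_trans h).
have : ((1 + x)^-1 <= 1 - x + x ^+ 2)%R.
  rewrite -[leLHS]mul1r ler_pdivrMr ?ltr_pwDl//.
  rewrite -subr_ge0 (_ : ((1 - x + x ^+ 2) * (1 + x) - 1 = x ^+ 3)%R); last by ring.
  exact: exprn_ge0.
nra.
Qed.

(** The convexity bound is multiplied by [p] and integrated. Keeping the loss on the left avoids a
    subtraction in the extended reals, since the second moment may be infinite. *)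
Lemma normalizer_le k w :
  {ae rho, forall z, p k w z = 0%R -> q z = 0%R} ->
  (normalizer k w + lambda * expected_loss q)%:E <=
  1 + (lambda ^+ 2)%:E *
    \int[rho]_z ((p k w z)%:E * (q z * ell z ^+ 2 / p k w z ^+ 2)%:E).
Proof.
move=> cov.
have mpE : measurable_fun setT (fun z => (p k w z)%:E) by exact/measurable_EFinP.
have mpgE : measurable_fun setT (fun z => (p k w z)%:E * (g k w z)%:E).
  by apply: emeasurable_funM => //; exact/measurable_EFinP.
have mqeE : measurable_fun setT (fun z => (q z * ell z)%:E).
  by apply/measurable_EFinP; exact: measurable_funM.
pose u z := (q z * ell z ^+ 2 / p k w z ^+ 2)%R.
have u0 z : (0 <= u z)%R by rewrite divr_ge0 ?mulr_ge0 ?exprn_ge0.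
have mu : measurable_fun setT u.
  apply: measurable_funM.
    by apply: measurable_funM => //; exact: measurable_funX.
  apply: measurable_funV_ge0; first by move=> z; rewrite exprn_ge0.
  exact: measurable_funX.
have mpuE : measurable_fun setT (fun z => (p k w z)%:E * (u z)%:E).
  by apply: emeasurable_funM => //; exact/measurable_EFinP.
have pg0 z : 0 <= (p k w z)%:E * (g k w z)%:E by rewrite mule_ge0// lee_fin.
have qe0 z : 0 <= (q z * ell z)%:E by rewrite lee_fin mulr_ge0.
have pu0 z : 0 <= (p k w z)%:E * (u z)%:E by rewrite mule_ge0// lee_fin.
have pE0 z : 0 <= (p k w z)%:E by rewrite lee_fin.
have l0 : 0 <= lambda%:E by rewrite lee_fin ltW.
have l20 : 0 <= (lambda ^+ 2)%:E by rewrite lee_fin exprn_ge0// ltW.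
rewrite EFinD -normalizerE EFinM -expected_lossE// -[X in X + _ * _](p1 k w).
rewrite -(ge0_integralZl rho measurableT mqeE (fun z _ => qe0 z) l0).
rewrite -(ge0_integralZl rho measurableT mpuE (fun z _ => pu0 z) l20).
rewrite -ge0_integralD//; last 2 first.
- by move=> z _; exact: mule_ge0.
- exact: emeasurable_funM.
rewrite -ge0_integralD//; last 2 first.
- by move=> z _; exact: mule_ge0.
- exact: emeasurable_funM.
apply: ae_ge0_le_integral => //.
- by move=> z _; rewrite adde_ge0// mule_ge0.
- by apply: emeasurable_funD => //; exact: emeasurable_funM.
- by move=> z _; rewrite adde_ge0// mule_ge0.
- by apply: emeasurable_funD => //; exact: emeasurable_funM.
apply: filterS cov => z cz _.
rewrite -!(EFinM, EFinD) lee_fin.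
(* Where [p] vanishes, the convexity bound does not see the term [lambda * q * ell]; coverage makes
   [q] vanish there too. *)
have [pz|pz] := eqVneq (p k w z) 0%R.
  by rewrite pz (cz pz) !mul0r !mulr0.
have := ler_wpM2l (p0 k w z) (expR_convex_bound (q01 z) (v0 k w z)).
rewrite -/(log_weight k w z) -/(g k w z) => h.
have -> : (p k w z + lambda ^+ 2 * (p k w z * u z) =
    p k w z * (1 - q z * v k w z + q z * v k w z ^+ 2) + lambda * (q z * ell z))%R.
  by rewrite /u /v; field.
by rewrite lerD2r.
Qed.

End fixed_policy.
End logarithmic_smoothing.

(** * Policies as densities *)

Section finite_measure_of.
Context d (T : measurableType d) (R : realType) (mu : {measure set T -> \bar R}).
Hypothesis mufin : fin_num_fun mu.

Let mu' : set T -> \bar R := mu.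
HB.instance Definition _ := Measure.copy mu' mu.
HB.instance Definition _ := @Measure_isFinite.Build _ _ _ mu' mufin.

Lemma finite_measure_of :
  exists rho : {finite_measure set T -> \bar R}, rho = mu :> (set T -> \bar R).
Proof. by exists mu'. Qed.

End finite_measure_of.

(** * A base measure dominating the laws of all policies *)

Section base_measure.
Context (R : realType) (d K : nat).
Variables (X : set (ctx R d)) (nu : probability (ctx R d) R).
Variable p : R.-pker (ctx R d * 'I_K.+1)%type ~> R.
Hypothesis mX : measurable X.
Local Notation T := (triple R d K).

(** Integration against [nu] on [X], the counting measure on actions and [p]; it is finite because
    there are finitely many actions. *)
Let Phi (g : T -> \bar R) : \bar R :=
  \int[nu]_(x in X) \sum_(a < K.+1) \int[p (x, a)]_c g (x, a, c).

Let mPhi (g : T -> \bar R) a : (forall z, 0 <= g z) -> measurable_fun setT g ->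
  measurable_fun X (fun x => \int[p (x, a)]_c g (x, a, c)).
Proof.
move=> g0 mg; apply: measurable_funTS.
have := measurable_fun_integral_finite_kernel g p g0 mg.
by move=> h; exact: (measurableT_comp h (measurable_pair2 a)).
Qed.

Let mgc (g : T -> \bar R) x a : measurable_fun setT g ->
  measurable_fun setT (fun c => g (x, a, c)).
Proof. by move=> mg; exact: (measurableT_comp mg (measurable_pair1 (x, a))). Qed.

Let positive_functional_Phi : positive_functional Phi.
Proof.
split.
- move=> g g0 mg; apply: integral_ge0 => x _; apply: sume_ge0 => a _.
  exact: integral_ge0.
- move=> g h g0 mg h0 mh; rewrite /Phi -ge0_integralD//.
  + apply: eq_integral => x _; rewrite -big_split/=; apply: eq_bigr => a _.
    by rewrite ge0_integralD//; exact: mgc.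
  + by move=> x _; apply: sume_ge0 => a _; exact: integral_ge0.
  + by apply: emeasurable_sum => a; exact: mPhi.
  + by move=> x _; apply: sume_ge0 => a _; exact: integral_ge0.
  + by apply: emeasurable_sum => a; exact: mPhi.
- move=> c g c0 g0 mg; rewrite /Phi -ge0_integralZl ?lee_fin//.
  + apply: eq_integral => x _; rewrite ge0_sume_distrr; last first.
      by move=> a _; exact: integral_ge0.
    apply: eq_bigr => a _; rewrite ge0_integralZl ?lee_fin//.
    exact: mgc.
  + by apply: emeasurable_sum => a; exact: mPhi.
  + by move=> x _; apply: sume_ge0 => a _; exact: integral_ge0.
- move=> g g0 mg gnd; rewrite /Phi -monotone_convergence//.
  + apply: eq_integral => x _.
    apply/esym/cvg_lim => //; apply: cvg_nnesum => a _.
      by apply: nearW => n; exact: integral_ge0.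
    apply: cvg_monotone_convergence => //.
    by move=> n; exact: mgc.
  + by move=> n; apply: emeasurable_sum => a; exact: (mPhi a (g0 n) (mg n)).
  + by move=> n x _; apply: sume_ge0 => a _; exact: integral_ge0.
  + move=> x _ i j ij; apply: lee_sum => a _.
    by apply: ge0_le_integral => //; [exact: mgc|exact: mgc|move=> c _; exact: gnd].
Qed.

Lemma base_measure : exists rho : {finite_measure set T -> \bar R},
  forall g : T -> \bar R, (forall z, 0 <= g z) -> measurable_fun setT g ->
  \int[rho]_z g z =
  \int[nu]_(x in X) \sum_(a < K.+1) \int[p (x, a)]_c g (x, a, c).
Proof.
have [mu muE] := positive_functional_measure positive_functional_Phi.
have mufin : fin_num_fun mu.
  apply: lty_fin_num_fun.
  have -> : mu [set: T] = Phi (cst 1) by rewrite muE// integral_cst// mul1e.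
  apply: (@le_lt_trans _ _ (\int[nu]_(x in X) (K.+1%:R%:E : \bar R))).
    apply: ge0_le_integral => //.
    - by move=> x _; apply: sume_ge0 => a _; exact: integral_ge0.
    - by apply: emeasurable_sum => a; exact: mPhi.
    - move=> x _.
      rewrite (eq_bigr (fun=> 1%:E)); last first.
        by move=> a _; rewrite integral_cst// mul1e prob_kernel.
      by rewrite sumEFin sumr_const card_ord.
  rewrite integral_cst//=; apply: lte_mul_pinfty => //.
  by rewrite (le_lt_trans (probability_le1 nu mX))// ltry.
have [rho rhoE] := finite_measure_of mufin.
exists rho => g g0 mg; rewrite [RHS](muE g g0 mg).
by apply: eq_measure_integral => A mA _; rewrite rhoE.
Qed.

End base_measure.

(** * Risks and second moments as integrals against the base measure *)

Section triple_integral.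
Context (R : realType) (d K : nat).
Variables (X : set (ctx R d)) (nu : probability (ctx R d) R).
Variable p : R.-pker (ctx R d * 'I_K.+1)%type ~> R.
Hypotheses (mX : measurable X) (nuX : nu X = 1)
  (p_cost : forall x a, X x -> p (x, a) [set c : R | (-1 <= c <= 0)%R] = 1).
Local Notation T := (triple R d K).
Variable rho : {finite_measure set T -> \bar R}.
Hypothesis rhoE : forall g : T -> \bar R, (forall z, 0 <= g z) ->
  measurable_fun setT g -> \int[rho]_z g z =
  \int[nu]_(x in X) \sum_(a < K.+1) \int[p (x, a)]_c g (x, a, c).

Definition admissible : set T := [set z | X z.1.1 /\ (-1 <= z.2 <= 0)%R].

Local Notation D := admissible.

(** Policies are unconstrained outside [X]; the cut-off gives densities that are nonnegative and
    measurable on the whole space of triples. *)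
Definition on_admissible (q : policy R d K) (z : T) : R :=
  (q z.1.1 z.1.2 * \1_D z)%R.

Lemma on_admissibleE q z : D z -> on_admissible q z = q z.1.1 z.1.2.
Proof. by move=> Dz; rewrite /on_admissible indicE mem_set// mulr1. Qed.

Lemma measurable_cost_range : measurable [set c : R | (-1 <= c <= 0)%R].
Proof.
rewrite (_ : mkset _ = `[(-1)%R, 0%R]%classic); first exact: measurable_itv.
by apply/seteqP; split => c /=; rewrite in_itv.
Qed.

Lemma measurable_admissible : measurable D.
Proof.
rewrite (_ : D = (fun z : T => z.1.1) @^-1` X `&`
    (snd : T -> R) @^-1` [set c : R | (-1 <= c <= 0)%R])//.
apply: measurableI; rewrite -[X in measurable X]setTI.
- have mf : measurable_fun setT (fun z : T => z.1.1).
    exact: (measurableT_comp measurable_fst measurable_fst).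
  exact: (mf measurableT _ mX).
- exact: (@measurable_snd _ _ _ _ measurableT _ measurable_cost_range).
Qed.

(** There are finitely many actions, and on each slice [S a] the policy is evaluated at a constant
    action, where joint measurability is given. *)
Lemma measurable_on_admissible dY (Y : measurableType dY)
    (F : Y -> policy R d K) :
  (forall a, measurable_fun ([set: Y] `*` X)
    (fun y : Y * ctx R d => F y.1 y.2 a)) ->
  measurable_fun setT (fun x : Y * T => on_admissible (F x.1) x.2).
Proof.
move=> mF.
pose S (a : 'I_K.+1) : set (Y * T) := [set x | D x.2 /\ x.2.1.2 = a].
have mS a : measurable (S a).
  rewrite (_ : S a = (snd @^-1` D) `&` ((fun x : Y * T => x.2.1.2) @^-1` [set a]))//.
  apply: measurableI; rewrite -[X in measurable X]setTI.
    exact: (@measurable_snd _ _ _ _ measurableT _ measurable_admissible).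
  have mf : measurable_fun setT (fun x : Y * T => x.2.1.2).
    exact: (measurableT_comp measurable_snd (measurableT_comp measurable_fst measurable_snd)).
  exact: (mf measurableT [set a]).
rewrite (_ : (fun _ => _) = (fun x : Y * T =>
    \sum_(a < K.+1) ((fun x : Y * T => F x.1 x.2.1.1 a) \_ (S a)) x)%R); last first.
  apply/funext => x; rewrite /on_admissible.
  have [Dx|Dx] := pselect (D x.2).
    rewrite (bigD1 x.2.1.2)//= big1 ?addr0; last first.
      move=> a /negP ax; rewrite patchE memNset// => -[_ xa].
      by apply: ax; rewrite xa.
    by rewrite patchE mem_set// indicE mem_set// mulr1.
  rewrite indicE memNset// mulr0 big1// => a _.
  by rewrite patchE memNset// => -[].
apply: measurable_sum => a; apply/(measurable_restrictT _ (mS a)).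
pose phi (x : Y * T) : Y * ctx R d := (x.1, x.2.1.1).
have mphi : measurable_fun (S a) phi.
  apply: measurable_funTS; apply: measurable_fun_pair => //.
  exact: (measurableT_comp measurable_fst (measurableT_comp measurable_fst measurable_snd)).
apply: (@measurable_comp _ _ _ _ _ _ ([set: Y] `*` X)
  (fun y : Y * ctx R d => F y.1 y.2 a) (S a) phi) => //.
- exact: measurableX.
- by move=> _ [x [[Dx _] _] <-].
Qed.

Lemma cost_ae x a : X x -> {ae p (x, a), forall c : R, (-1 <= c <= 0)%R}.
Proof.
move=> Xx; exists (~` [set c : R | (-1 <= c <= 0)%R]); split => //.
  by apply: measurableC; exact: measurable_cost_range.
have h : p (x, a) setT = 1 by exact: prob_kernel.
have hfin : p (x, a) setT < +oo by rewrite h ltry.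
rewrite -setTD.
transitivity (p (x, a) setT - p (x, a) (setT `&` [set c : R | (-1 <= c <= 0)%R])).
  by apply: measureD => //; exact: measurable_cost_range.
rewrite setTI p_cost//.
by rewrite [X in X - 1](h : p (x, a) setT = 1) subee.
Qed.

(** Integrals against [rho] are only known for nonnegative functions, so the integrand [g] is
    replaced by a nonnegative [h]; for a context in [X] they differ only at costs that are null
    under [p (x, a)]. *)
Lemma expectation_policyE (q : policy R d K) (g h : T -> \bar R) :
  (forall x a, X x -> 0 <= q x a)%R ->
  measurable_fun setT (on_admissible q) ->
  (forall z, 0 <= h z) -> measurable_fun setT h -> (forall z, D z -> g z = h z) ->
  (forall x a, X x -> measurable_fun setT (fun c => g (x, a, c))) ->
  expectation_policy X nu p q g = \int[rho]_z ((on_admissible q z)%:E * h z).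
Proof.
move=> q0 mq h0 mh gh mg.
have q0' z : (0 <= on_admissible q z)%R.
  rewrite /on_admissible indicE; case: (boolP (z \in D)) => [/set_mem[Xz _]|_].
    by rewrite mulr1 q0.
  by rewrite mulr0.
rewrite rhoE; last 2 first.
- by move=> z; rewrite mule_ge0// lee_fin.
- by apply: emeasurable_funM => //; exact/measurable_EFinP.
rewrite /expectation_policy; apply: eq_integral => x /set_mem Xx.
apply: eq_bigr => a _.
have mhc : measurable_fun setT (fun c => h (x, a, c)).
  exact: (measurableT_comp mh (measurable_pair1 (x, a))).
have mqc : measurable_fun setT (fun c => on_admissible q (x, a, c)).
  exact: (measurableT_comp mq (measurable_pair1 (x, a))).
transitivity ((q x a)%:E * \int[p (x, a)]_c h (x, a, c)).
  congr (_ * _); apply: ae_eq_integral => //; first exact: mg.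
  by apply: filterS (cost_ae a Xx) => c hc _; rewrite gh.
rewrite -ge0_integralZl ?lee_fin ?q0//.
apply: ge0_ae_eq_integral => //.
- exact: emeasurable_funM.
- by apply: emeasurable_funM => //; exact/measurable_EFinP.
- by move=> c _; rewrite mule_ge0// lee_fin q0.
- by move=> c _; rewrite mule_ge0// lee_fin.
by apply: filterS (cost_ae a Xx) => c hc _; rewrite on_admissibleE.
Qed.

Definition loss (z : T) : R := (- z.2 * \1_D z)%R.

Lemma loss01 z : (0 <= loss z <= 1)%R.
Proof.
rewrite /loss indicE; case: (boolP (z \in D)) => [/set_mem[_ /andP[h1 h2]]|_].
  by rewrite mulr1 oppr_ge0 h2/= lerNl.
by rewrite mulr0 lexx ler01.
Qed.

Lemma measurable_loss : measurable_fun setT loss.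
Proof.
apply: measurable_funM; last by apply: measurable_indic; exact: measurable_admissible.
by apply: measurableT_comp => //; exact: measurable_snd.
Qed.

Lemma lossE z : D z -> loss z = (- z.2)%R.
Proof. by move=> Dz; rewrite /loss indicE mem_set// mulr1. Qed.

Lemma riskE (q : policy R d K) :
  (forall x a, X x -> 0 <= q x a)%R -> measurable_fun setT (on_admissible q) ->
  risk X nu p q = - \int[rho]_z ((on_admissible q z)%:E * (loss z)%:E).
Proof.
move=> q0 mq.
have l0 z : 0 <= (loss z)%:E by rewrite lee_fin; have /andP[] := loss01 z.
have mlE : measurable_fun setT (EFin \o loss).
  by apply/measurable_EFinP; exact: measurable_loss.
have mlc x a : measurable_fun setT (fun c => (loss (x, a, c))%:E).
  exact: (measurableT_comp mlE (measurable_pair1 (x, a))).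
rewrite -(@expectation_policyE q (EFin \o loss) (EFin \o loss))//; last first.
  by move=> x a _; exact: mlc.
rewrite /risk /expectation_policy -integral_ge0N; last first.
  move=> x Xx; apply: sume_ge0 => a _.
  by apply: mule_ge0; [rewrite lee_fin q0|apply: integral_ge0 => c _; exact: l0].
apply: eq_integral => x /set_mem Xx.
have lfin a : \int[p (x, a)]_c (loss (x, a, c))%:E \is a fin_num.
  rewrite ge0_fin_numE; last by apply: integral_ge0 => c _; exact: l0.
  apply: (@le_lt_trans _ _ (\int[p (x, a)]_c (1%:E : \bar R))).
    apply: ge0_le_integral => //.
    by move=> c _; rewrite lee_fin; have /andP[] := loss01 (x, a, c).
  rewrite integral_cst//.
  by rewrite prob_kernel mule1 ltry.
(* Bounded losses make each inner integral finite, so that the sign passes through the sum over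
   actions. *)
rewrite -fin_num_sumeN; last by move=> a _; exact: fin_numM.
apply: eq_bigr => a _; rewrite -muleN; congr (_ * _).
rewrite -integral_ge0N; last by move=> c _; exact: l0.
apply: ae_eq_integral => //.
- by apply/measurable_EFinP; exact: measurable_id.
- by apply: measurableT_comp => //; exact: mlc.
by apply: filterS (cost_ae a Xx) => c hc _; rewrite /= lossE//= opprK.
Qed.

(** The null set of contexts is lifted to triples; [rho] gives the lift [K + 1] times its
    [nu]-measure inside [X]. *)
Lemma covers_ae (q q' : policy R d K) : covers X nu q q' ->
  {ae rho, forall z, on_admissible q z = 0%R -> on_admissible q' z = 0%R}.
Proof.
move=> [N [mN nuN hN]].
have mf : measurable_fun setT (fun z : T => z.1.1).
  exact: (measurableT_comp measurable_fst measurable_fst).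
exists ((fun z : T => z.1.1) @^-1` N); split.
- by rewrite -[X in measurable X]setTI; exact: mf.
- have mB : measurable ((fun z : T => z.1.1) @^-1` N).
    by rewrite -[X in measurable X]setTI; exact: mf.
  have i0 z : 0 <= (\1_((fun z : T => z.1.1) @^-1` N) z : R)%:E by rewrite lee_fin.
  rewrite -[X in rho X]setIT -integral_indic//.
  rewrite rhoE//; last by apply/measurable_EFinP; exact: measurable_indic.
  transitivity (\int[nu]_(x in X) (K.+1%:R%:E * (\1_N x : R)%:E)).
    apply: eq_integral => x _.
    rewrite (eq_bigr (fun=> (\1_N x)%:E)); last first.
      move=> a _; transitivity (\int[p (x, a)]_c ((\1_N x : R)%:E : \bar R)).
        exact: eq_integral.
      by rewrite integral_cst// prob_kernel mule1.
    by rewrite sumEFin sumr_const card_ord -EFinM mulr_natl.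
  rewrite ge0_integralZl ?lee_fin//; last first.
    by apply/measurable_EFinP/measurable_funTS; exact: measurable_indic.
  have nuNX : nu (N `&` X) = 0.
    by apply: (subset_measure0 _ mN _ nuN) => //; exact: measurableI.
  by rewrite integral_indic// [X in _ * X]nuNX mule0.
- move=> z /= /not_implyP[qz q'z]; apply: hN => /= h.
  have [Dz|Dz] := pselect (D z); last first.
    by apply: q'z; rewrite /on_admissible indicE memNset// mulr0.
  apply: q'z; rewrite on_admissibleE//; apply: h; first by case: Dz.
  by rewrite -(on_admissibleE q Dz).
Qed.

End triple_integral.

(** Gibbs' inequality is the change of measure for the zero function. *)
Lemma KL_ge0 d (T : measurableType d) (R : realType) (Q P : probability T R) :
  0 <= KL Q P.
Proof.
have := @donsker_varadhan _ _ _ Q P (cst 0%R) 1%R 0%R (measurable_cst _).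
rewrite ln1 adde0 => h.
rewrite -[leLHS](integral0 Q setT); apply: h => //.
- by move=> t; rewrite normr0.
- under eq_integral do rewrite expR0.
  by rewrite integral_cst//= probability_setT mule1.
Qed.

(** * Mixture policies as averages of predictors *)

Section mixture_policies.
Context (R : realType) (d K : nat).
Variables (X : set (ctx R d)) (nu : probability (ctx R d) R).
Variable p : R.-pker (ctx R d * 'I_K.+1)%type ~> R.
Hypotheses (mX : measurable X) (nuX : nu X = 1)
  (p_cost : forall x a, X x -> p (x, a) [set c : R | (-1 <= c <= 0)%R] = 1).
Local Notation T := (triple R d K).
Context (dT : measure_display) (Theta : measurableType dT).
Variable f : Theta -> ctx R d -> 'I_K.+1.
Hypothesis mf : measurable_fun ([set: Theta] `*` X)
  (fun z : Theta * ctx R d => f z.1 z.2).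
Variable rho : {finite_measure set T -> \bar R}.
Hypothesis rhoE : forall g : T -> \bar R, (forall z, 0 <= g z) ->
  measurable_fun setT g -> \int[rho]_z g z =
  \int[nu]_(x in X) \sum_(a < K.+1) \int[p (x, a)]_c g (x, a, c).

(** The predictors are measurable only for contexts in [X]; the cut-off makes this jointly
    measurable everywhere. *)
Definition plays (t : Theta) (z : T) : bool :=
  (f t z.1.1 == z.1.2) && (z \in admissible X).

Lemma measurable_plays : measurable_fun setT
  (fun x : Theta * T => (plays x.1 x.2)%:R%R : R).
Proof.
pose F t : policy R d K := fun x a => (f t x == a)%:R%R.
rewrite (_ : (fun _ => _) = fun x : Theta * T => on_admissible X (F x.1) x.2).
  apply: measurable_on_admissible => // a.
  have mg : measurable_fun setT (fun b : 'I_K.+1 => (b == a)%:R%R : R) by [].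
  exact: (measurableT_comp mg mf).
by apply/funext => x; rewrite /plays /on_admissible indicE -mulnb natrM.
Qed.

Lemma mix_policyE (Q : probability Theta R) :
  (fun z => (\int[Q]_t (plays t z)%:R)%R) = on_admissible X (mix_policy f Q).
Proof.
apply/funext => z; rewrite /on_admissible indicE.
have [Dz|Dz] := boolP (z \in admissible X).
  rewrite mulr1; congr fine; apply: eq_integral => t _.
  by rewrite /plays Dz andbT.
rewrite mulr0 -[RHS](_ : fine 0 = 0%R)//; congr fine.
by apply: integral0_eq => t _; rewrite /plays (negbTE Dz) andbF.
Qed.

(** Cost 0 gives an admissible triple over every context of [X], so facts about densities on triples
    can be read back as facts about policies. *)
Let zero_cost x a : X x -> admissible X ((x, a, 0%R) : T).
Proof. by move=> Xx; split => //=; rewrite lexx lerN10. Qed.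

Lemma mix_policy01 (Q : probability Theta R) x a : X x ->
  (0 <= mix_policy f Q x a <= 1)%R.
Proof.
move=> Xx; have := mean_action01 measurable_plays Q ((x, a, 0%R) : T).
have := congr1 (@^~ ((x, a, 0%R) : T)) (mix_policyE Q) => /= ->.
by rewrite (on_admissibleE _ (zero_cost a Xx)).
Qed.

Lemma sum_mix_policy (Q : probability Theta R) x : X x ->
  \sum_(a < K.+1) (mix_policy f Q x a)%:E = 1.
Proof.
move=> Xx.
have mpl a : measurable_fun setT (fun t => ((f t x == a)%:R%R : R)%:E).
  have h := measurableT_comp measurable_plays (measurable_pair2 ((x, a, 0%R) : T)).
  apply/measurable_EFinP; apply: eq_measurable_fun h => t _ /=.
  by rewrite /plays mem_set ?andbT//; exact: zero_cost.
transitivity (\sum_(a < K.+1) \int[Q]_t ((f t x == a)%:R%R : R)%:E).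
  apply: eq_bigr => a _.
  have := integral_mean_action measurable_plays Q ((x, a, 0%R) : T).
  have := congr1 (@^~ ((x, a, 0%R) : T)) (mix_policyE Q) => /= ->.
  rewrite (on_admissibleE _ (zero_cost a Xx))/= => <-.
  apply: eq_integral => t _.
  by rewrite /plays mem_set ?andbT//; exact: zero_cost.
rewrite -ge0_integral_sum//.
transitivity (\int[Q]_t (1%:E : \bar R)).
  apply: eq_integral => t _; rewrite sumEFin (bigD1 (f t x))//= eqxx big1 ?addr0//.
  by move=> a /negbTE; rewrite eq_sym => ->.
by rewrite integral_cst//= probability_setT mule1.
Qed.

Lemma mix_policy_mass (Q : probability Theta R) :
  \int[rho]_z (on_admissible X (mix_policy f Q) z)%:E = 1.
Proof.
have mq : measurable_fun setT (on_admissible X (mix_policy f Q)).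
  by rewrite -mix_policyE; exact: (measurable_mean_action measurable_plays).
transitivity (expectation_policy X nu p (mix_policy f Q) (cst 1)).
  rewrite (@expectation_policyE _ _ _ _ _ _ p_cost _ rhoE _ (cst 1) (cst 1))//.
  - by apply: eq_integral => z _; rewrite mule1.
  - by move=> x a Xx; have /andP[] := mix_policy01 Q a Xx.
rewrite /expectation_policy.
transitivity (\int[nu]_(x in X) (1%:E : \bar R)).
  apply: eq_integral => x /set_mem Xx; rewrite -[RHS](sum_mix_policy Q Xx).
  by apply: eq_bigr => a _; rewrite integral_cst// prob_kernel !mule1.
by rewrite integral_cst// [X in _ * X]nuX mule1.
Qed.

End mixture_policies.

Lemma measurable_history (R : realType) (d K : nat) (dO : measure_display)
    (Omega : measurableType dO) (Pr : probability Omega R) (m : nat)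
    (Z : nat -> 'I_m -> {RV Pr >-> triple R d K}) k :
  history Z k `<=` measurable.
Proof.
move=> _ [j [i [B [jk mB ->]]]]; rewrite -[X in measurable X]setTI.
exact: (measurable_funP (Z j i)).
Qed.

(** * Excess risk *)

Theorem proposition3p3
  (R : realType) (d K : nat)
  (X : set (ctx R d)) (compactX : compact (X : set 'rV[R]_d))
  (nu : probability (ctx R d) R) (nuX : nu X = 1)
  (p : R.-pker (ctx R d * 'I_K.+1)%type ~> R)
  (p_cost : forall x a, X x -> p (x, a) [set c : R | (-1 <= c <= 0)%R] = 1)
  (dT : measure_display) (Theta : measurableType dT)
  (f : Theta -> ctx R d -> 'I_K.+1)
  (mf : measurable_fun ([set: Theta] `*` X)
          (fun z : Theta * ctx R d => f z.1 z.2))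
  (P : probability Theta R) (C : set (probability Theta R))
  (lambda delta : R) (lambda_gt0 : (0 < lambda)%R)
  (delta_gt0 : (0 < delta)%R) (delta_le1 : (delta <= 1)%R)
  (dO : measure_display) (Omega : measurableType dO)
  (Pr : probability Omega R)
  (m : nat) (m_gt0 : (0 < m)%N)
  (Z : nat -> 'I_m -> {RV Pr >-> triple R d K})
  (Z_X : forall k i w, X (Z k i w).1.1)
  (Z_cost : forall k i w, (-1 <= (Z k i w).2 <= 0)%R)
  (pi0 : policy R d K)
  (pi : nat -> Omega -> policy R d K)
  (pi_0 : forall w x a, X x -> pi 0%N w x a = pi0 x a)
  (prior : forall x a, X x -> mix_policy f P x a = pi0 x a)
  (pi_meas : forall k, history_measurable Z X k.+1 (pi k.+1))
  (Z_iid : forall k, conditionally_iid Z X nu p k (pi k))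
  (Qhat : nat -> Omega -> probability Theta R)
  (Qhat_argmin : forall k w,
     argmin C (fun Q => (LS_risk Z lambda pi k w (mix_policy f Q))%:E
                        + KL Q P * ((lambda * k.+1%:R * m%:R)^-1)%:E)
       (Qhat k.+1 w))
  (pi_S : forall k w x a, X x ->
     pi k.+1 w x a = mix_policy f (Qhat k.+1 w) x a)
  (Qstar : probability Theta R)
  (Qstar_argmin : argmin C (fun Q => risk X nu p (mix_policy f Q)) Qstar) :
  exists E : set Omega,
    [/\ measurable E, (1 - delta)%:E <= Pr E &
      forall w, E w -> forall k : nat,
        (forall j, (j <= k)%N -> covers X nu (pi j w) (mix_policy f Qstar)) ->
        risk X nu p (pi k.+1 w) - risk X nu p (mix_policy f Qstar) <=
          (lambda / k.+1%:R)%:E *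
            \sum_(j < k.+1) second_moment X nu p (pi j w) (mix_policy f Qstar)
          + 2%:E * ((KL Qstar P + (ln (2 / delta))%:E)
                     * ((lambda * k.+1%:R * m%:R)^-1)%:E)].
Proof.
have mX : measurable X.
  have cX : closed (X : set 'rV[R]_d) := compact_closed (@norm_hausdorff _ _) compactX.
  rewrite -(setCK X); apply: measurableC; apply: sub_sigma_algebra.
  exact: closed_openC.
have [rho rhoE] := base_measure nu p mX.
pose a := plays X f.
pose q (Q : probability Theta R) z := (\int[Q]_t (a t z)%:R)%R.
have qE Q : q Q = on_admissible X (mix_policy f Q) by exact: mix_policyE.
have ma := measurable_plays mX mf.
have q01 Q z : (0 <= q Q z <= 1)%R by exact: (mean_action01 ma Q z).
have mq Q : measurable_fun setT (q Q) by exact: (measurable_mean_action ma).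
have mix0 Q x b : X x -> (0 <= mix_policy f Q x b)%R.
  by move=> Xx; have /andP[] := mix_policy01 mX mf Q b Xx.
(* Through the prior the initial policy is a mixture too, so every [pi k w] inherits nonnegativity,
   mass 1 and measurability in the triple from mixtures. *)
have piQ k w : exists Q, forall x b, X x -> pi k w x b = mix_policy f Q x b.
  case: k => [|k]; last by exists (Qhat k.+1 w); exact: pi_S.
  by exists P => x b Xx; rewrite pi_0// -prior.
pose pj k w z := on_admissible X (pi k w) z.
have pjE k w Q : (forall x b, X x -> pi k w x b = mix_policy f Q x b) ->
    pj k w = q Q.
  move=> piE; rewrite qE; apply/funext => z; rewrite /pj /on_admissible indicE.
  have [/set_mem[Xz _]|_] := boolP (z \in admissible X); last by rewrite !mulr0.
  by rewrite piE.
have pj0 k w z : (0 <= pj k w z)%R.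
  by have [Q /pjE ->] := piQ k w; have /andP[] := q01 Q z.
have pj1 k w : \int[rho]_z (pj k w z)%:E = 1.
  have [Q /pjE ->] := piQ k w; rewrite qE.
  exact: (mix_policy_mass mX nuX p_cost mf rhoE).
have pi0' k w x b : X x -> (0 <= pi k w x b)%R.
  by move=> Xx; have [Q ->//] := piQ k w; exact: mix0.
have mpjw k w : measurable_fun setT (pj k w).
  by have [Q /pjE ->] := piQ k w; exact: mq.
have mpj k : measurable_fun setT
    (fun x : g_sigma_algebraType (history Z k) * triple R d K => pj k x.1 x.2).
  (* At time 0 the past is trivial, and the policy is the same prior mixture for every [w]. *)
  case: k => [|k]; last first.
    by apply: (measurable_on_admissible mX); exact: pi_meas.
  rewrite (_ : (fun _ => _) = q P \o snd).
    exact: (measurableT_comp (mq P) measurable_snd).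
  apply/funext => x /=; rewrite (pjE 0%N x.1 P)// => y b Xy.
  by rewrite pi_0// -prior.
have HM k := @measurable_history _ _ _ _ _ Pr m Z k.
have Hmono j k : (j <= k)%N -> history Z j `<=` history Z k.
  by move=> jk _ [l [i [B [lj mB ->]]]]; exists l, i, B; split => //; exact: leq_trans lj jk.
have mZ k i : measurable_fun setT (Z k i) by exact: measurable_funP.
have Zad j k i : (j < k)%N ->
    measurable_fun setT (Z j i : g_sigma_algebraType (history Z k) -> triple R d K).
  move=> jk _ B mB; rewrite setTI; apply: sub_sigma_algebra.
  by exists j, i, B.
have lawE k w B : measurable B -> law_policy X nu p (pi k w) B =
    \int[rho]_z ((pj k w z)%:E * (\1_B z)%:E).
  move=> mB.
  have mi : measurable_fun setT (fun z : triple R d K => (\1_B z : R)%:E).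
    by apply/measurable_EFinP; exact: measurable_indic.
  have i0 z : 0 <= (\1_B z : R)%:E by rewrite lee_fin.
  apply: (expectation_policyE p_cost rhoE (pi0' k w) (mpjw k w) i0 mi) => //.
  by move=> x b _; exact: (measurableT_comp mi (measurable_pair1 (x, b))).
have Ziid k (G : set Omega) (B : 'I_m -> set (triple R d K)) :
    <<s history Z k >> G -> (forall i, measurable (B i)) ->
    Pr (G `&` [set w | forall i, B i (Z k i w)]) =
    \int[Pr]_(w in G) \prod_(i < m) \int[rho]_z ((pj k w z)%:E * (\1_(B i) z)%:E).
  move=> sG mB; rewrite Z_iid//; apply: eq_integral => w _.
  by apply: eq_bigr => i _; exact: lawE.
pose qs := q Qstar.
have ml : measurable_fun [set: triple R d K] (loss X) by exact: measurable_loss.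
have l01 := @loss01 R d K X.
have [E [mE PE hE]] := log_smoothing_event P HM Hmono pj0 mpj pj1 m_gt0 mZ Zad
  Ziid lambda_gt0 l01 ml ma (q01 Qstar) (mq Qstar) delta_gt0.
exists E; split => // w Ew k cov.
(* The index is [k.+1] because the batches [S_0], ..., [S_k] are used; the posterior [Qhat] is
   inserted once [w] is fixed. *)
have [hU hL] := hE w Ew k.+1.
have {hU} hU := hU (Qhat k.+1 w).
pose lw j i := log_weight pj lambda (loss X) j w (Z j i w).
pose el Q := expected_loss rho (loss X) (q Q).
pose A Q := (\sum_(j < k.+1) \sum_(i < m) (q Q (Z j i w) * lw j i))%R.
pose n : R := (lambda * k.+1%:R * m%:R)%R.
have m0 : (0 < m%:R :> R)%R by rewrite ltr0n.
have k0 : (0 < k.+1%:R :> R)%R by rewrite ltr0n.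
have n0 : (0 < n)%R by rewrite !mulr_gt0.
have ZD j i : admissible X (Z j i w) by split; [exact: Z_X|exact: Z_cost].
(* The factor [1 / lambda] joins [(k + 1) m] in [n], which puts estimator and penalty on the same
   scale. *)
have LSE Q : LS_risk Z lambda pi k w (mix_policy f Q) = (- A Q / n)%R.
  rewrite /LS_risk /A !mulNr; congr (- _)%R.
  rewrite mulr_sumr mulr_suml; apply: eq_bigr => j _.
  rewrite mulr_sumr mulr_suml; apply: eq_bigr => i _.
  have Dz := ZD j i; rewrite /lw /log_weight (lossE Dz) qE (on_admissibleE _ Dz).
  rewrite /pj (on_admissibleE _ Dz).
  case: (Z j i w) => -[x b] c /=.
  rewrite mulrN mulNr /n natrM.
  by field; rewrite !gt_eqF.
have riskQ Q : risk X nu p (mix_policy f Q) = (- el Q)%:E.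
  rewrite (riskE mX p_cost rhoE (mix0 Q)) -?qE//.
  rewrite EFinN /el -(expected_lossE rho l01 ml (q01 Q) (mq Q)).
  by congr (- _); apply: eq_integral => z _.
have riskpi : risk X nu p (pi k.+1 w) = risk X nu p (mix_policy f (Qhat k.+1 w)).
  apply: eq_integral => x /set_mem Xx; apply: eq_bigr => b _.
  by rewrite pi_S.
have SE j : second_moment X nu p (pi j w) (mix_policy f Qstar) =
    \int[rho]_z ((pj j w z)%:E * (qs z * loss X z ^+ 2 / pj j w z ^+ 2)%:E).
  apply: (expectation_policyE p_cost rhoE (pi0' j w) (mpjw j w)).
  - move=> z; rewrite lee_fin divr_ge0 ?exprn_ge0// mulr_ge0 ?exprn_ge0//.
      by have /andP[] := q01 Qstar z.
    by have /andP[] := l01 z.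
  - apply/measurable_EFinP; apply: measurable_funM.
      by apply: measurable_funM; [exact: mq|exact: measurable_funX].
    apply: measurable_funV_ge0; first by move=> z; rewrite exprn_ge0.
    by apply: measurable_funX; exact: mpjw.
  - move=> z Dz; rewrite (lossE Dz) sqrrN /qs qE (on_admissibleE _ Dz).
    by rewrite /pj (on_admissibleE _ Dz).
  - move=> x b Xx; apply/measurable_EFinP => /=; apply: measurable_funM => //.
    by apply: measurable_funM => //; exact: measurable_funX.
have S0 j : 0 <= second_moment X nu p (pi j w) (mix_policy f Qstar).
  rewrite SE; apply: integral_ge0 => z _; rewrite mule_ge0// lee_fin//.
  have /andP[qz0 _] := q01 Qstar z.
  by rewrite divr_ge0 ?exprn_ge0// mulr_ge0// exprn_ge0//; have /andP[] := l01 z.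
pose N j := normalizer rho pj lambda (loss X) qs j w.
have NS j : (j <= k)%N -> (N j + lambda * el Qstar)%:E <=
    1 + (lambda ^+ 2)%:E * second_moment X nu p (pi j w) (mix_policy f Qstar).
  move=> jk; rewrite SE.
  apply: (normalizer_le pj0 mpj pj1 lambda_gt0 l01 ml (q01 Qstar) (mq Qstar)).
  by rewrite /qs qE; apply: (covers_ae mX rhoE); exact: cov.
have KLs0 := KL_ge0 Qstar P.
have KLh0 := KL_ge0 (Qhat k.+1 w) P.
have [Cstar _] := Qstar_argmin.
have [_ /(_ Qstar Cstar) h_arg0] := Qhat_argmin k w.
move: h_arg0; rewrite !LSE riskpi !riskQ => h_arg.
set S := fun j => second_moment X nu p (pi j w) (mix_policy f Qstar) in S0 NS.
set l := ln (2 / delta) in hU hL *.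
have nV0 : (0 < n^-1)%R by rewrite invr_gt0.
have sumS0 : 0 <= \sum_(j < k.+1) S j by apply: sume_ge0 => j _; exact: S0.
have lk0 : (0 < lambda / k.+1%:R)%R by rewrite divr_gt0.
have lkS0 : 0 <= (lambda / k.+1%:R)%:E * \sum_(j < k.+1) S j.
  by rewrite mule_ge0// lee_fin ltW.
(* An infinite divergence of [Qstar] makes the right-hand side infinite. *)
move: (KL Qstar P) KLs0 h_arg => [x| |] // x0 h_arg; last first.
  rewrite addye// gt0_mulye ?lte_fin// gt0_muley ?lte_fin// addey ?leey//.
  by rewrite gt_eqF// (lt_le_trans _ lkS0)// ltNy0.
(* An infinite divergence of [Qhat] contradicts its optimality, since the objective is finite at
   [Qstar]. *)
move: (KL (Qhat k.+1 w) P) KLh0 hU h_arg => [y| |] // y0 hU h_arg; last first.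
  by move: h_arg; rewrite gt0_mulye ?lte_fin// addey// -EFinM -EFinD leNgt ltry.
have [/existsP[j /eqP Sj]|/existsPn Sfin] := boolP [exists j : 'I_k.+1, S j == +oo].
  have -> : \sum_(j < k.+1) S j = +oo.
    apply/eqP; rewrite esum_eqy => [|i _].
      by apply/existsP; exists j; rewrite Sj.
    by rewrite gt_eqF// (lt_le_trans _ (S0 i))// ltNy0.
  by rewrite gt0_muley ?lte_fin// addye ?leey.
pose s j := fine (S j).
have SsE (j : 'I_k.+1) : S j = (s j)%:E.
  have := Sfin j; rewrite -ltey => Sj.
  by rewrite /s fineK// ge0_fin_numE//; exact: S0.
under eq_bigr do rewrite -/(S _) SsE.
rewrite sumEFin.
move: h_arg hU hL; rewrite -!(EFinM, EFinD, EFinN) !lee_fin => h_arg hU hL.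
have NSr (j : 'I_k.+1) : (lambda * el Qstar - lambda ^+ 2 * s j <= 1 - N j)%R.
  have := NS j (ltn_ord j : (j <= k)%N); rewrite -/(S j) SsE -!(EFinM, EFinD) lee_fin; lra.
have sumN : (k.+1%:R * (lambda * el Qstar) - lambda ^+ 2 * \sum_(j < k.+1) s j <=
    \sum_(j < k.+1) (1 - N j))%R.
  apply: le_trans (ler_sum _ (fun j _ => NSr j)).
  by rewrite sumrB sumr_const card_ord -mulr_sumr mulr_natl.
have hU' : (A (Qhat k.+1 w) - n * el (Qhat k.+1 w) <= y + l)%R.
  apply: le_trans hU; rewrite le_eqVlt; apply/orP; left; apply/eqP.
  under [RHS]eq_bigr do rewrite sumrB sumr_const card_ord.
  rewrite sumrB sumr_const card_ord -mulrnA; congr (_ - _)%R.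
  by rewrite -[RHS]mulr_natr natrM /n /el; ring.
have hL' : (- A Qstar + m%:R * \sum_(j < k.+1) (1 - N j) <= l)%R.
  apply: le_trans hL; rewrite le_eqVlt; apply/orP; left; apply/eqP.
  rewrite mulr_sumr /A -sumrN -big_split/=; apply: eq_bigr => j _.
  by rewrite big_split/= sumrN sumr_const card_ord mulr_natl.
have h_arg' : (- A (Qhat k.+1 w) + y <= - A Qstar + x)%R.
  by move: h_arg; rewrite -!mulrDl ler_pM2r.
(* After scaling by [n], with [R] the risk: [n R(Qhat) <= - A(Qhat) + y + l <= - A(Qstar) + x + l <=
   n R(Qstar) + m lambda^2 Sg + x + 2 l], and [0 <= x] concludes. *)
rewrite -(ler_pM2l n0).
have sumN' := ler_wpM2l (ltW m0) sumN.
set Sg := (\sum_(j < k.+1) s j)%R in sumN sumN' *.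
have -> : (n * (lambda / k.+1%:R * Sg + 2 * ((x + l) * n^-1)) =
    m%:R * (lambda ^+ 2 * Sg) + 2 * (x + l))%R.
  by rewrite /n; field; rewrite !gt_eqF.
have nE : (n * el Qstar = m%:R * (k.+1%:R * (lambda * el Qstar)))%R by rewrite /n; ring.
move: x0; rewrite lee_fin => x0.
lra.
Qed.
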